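(* Let $\mu$ be a positive measure on $\partial\mathbb{D}$ with Lebesgue decomposition $d\mu = w(\theta)\,\frac{d\theta}{2\pi} + d\mu_{\mathrm{s}}$. Let $I$ be an interval (arc) on $\partial\mathbb{D}$ such that (a) $w(\theta)>0$ for Lebesgue a.e. $e^{i\theta}\in I$; (b) $\mu$ is regular for $\partial\mathbb{D}$, that is, $\lim_{n\to\infty}(\rho_1\cdots\rho_n)^{1/n}=1$. Then, as $n\to\infty$, (i) $\displaystyle \int_I \frac{1}{n+1}\,K_n(e^{i\theta},e^{i\theta})\,d\mu_{\mathrm{s}}(\theta)\to 0$; (ii) $\displaystyle \int_I \left|1-w(\theta)\,\frac{1}{n+1}\,K_n(e^{i\theta},e^{i\theta})\right|\frac{d\theta}{2\pi}\to 0$.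
   Context: $\partial\mathbb{D}=\{z\in\mathbb{C}: |z|=1\}$. Measures are positive, finite, not necessarily normalized, and have infinite support. $\Phi_n(z)$ and $\varphi_n(z)=\Phi_n(z)/\|\Phi_n\|_{L^2(d\mu)}$ denote the monic and the normalized orthogonal polynomials of degree $n$ for $\mu$. With $\Phi_n^*(z)=z^n\,\overline{\Phi_n(1/\bar z)}$, the Verblunsky coefficients $\alpha_n$ are defined by $\Phi_{n+1}(z)=z\Phi_n(z)-\bar\alpha_n\Phi_n^*(z)$, and $\rho_n=(1-|\alpha_n|^2)^{1/2}$. The CD kernel is $K_n(z,w)=\sum_{j=0}^n \overline{\varphi_j(z)}\,\varphi_j(w)$. $\mu_{\mathrm{s}}$ is the part of $\mu$ singular with respect to Lebesgue measure. *)

(* Defs.v *)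
From HB Require Import structures.
From mathcomp Require Import all_boot all_order all_algebra complex.
From mathcomp Require Import all_classical all_reals all_analysis.

Set Implicit Arguments.
Unset Strict Implicit.
Unset Printing Implicit Defensive.

Import Order.TTheory GRing.Theory Num.Theory.
Import numFieldNormedType.Exports.

Local Open Scope classical_set_scope.
Local Open Scope ring_scope.

(* R[i] with its Borel sigma-algebra.  [R[i]^o] carries the norm topology. *)
Notation borelC R := (g_sigma_algebraType (@open R[i]^o)).

Section Circle.
Variable R : realType.

Definition circle : set R[i] := [set z | `|z| = 1].

Definition expi (t : R) : R[i] := Complex (cos t) (sin t).

(* One period of the angle; [expi] is a bijection from it onto [circle]. *)
Definition period : set R := `[0, 2 * pi[.

(* [J] is an arbitrary interval of angles, so arcs may contain either of their
   endpoints, may pass through 1, and may be all of the circle. *)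
Definition circle_arc (J : interval R) : set R[i] := expi @` [set` J].

End Circle.

Section Measures.
Variable R : realType.
Implicit Types mu mus : {measure set (borelC R) -> \bar R}.

(* A measure on the circle is a Borel measure on the plane that is carried by
   the circle. *)
Definition on_circle mu : Prop := mu (~` @circle R) = 0%E.

Definition msupport mu : set R[i] :=
  [set z | forall U : set R[i]^o, open U -> U z -> (0 < mu U)%E].

(* Singular with respect to (the image under [expi] of) Lebesgue measure. *)
Definition singular_circle mus : Prop :=
  exists N : set (borelC R), [/\ measurable N,
    mus (~` N) = 0%E &
    lebesgue_measure (@period R `&` (@expi R) @^-1` N) = 0%E].

(* d mu = w(t) dt/(2 pi) + d mus on the circle. *)
Definition lebesgue_decomposition mu (w : R -> R) mus : Prop :=
  [/\ measurable_fun (@period R) w,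
      (forall t, period t -> 0 <= w t),
      singular_circle mus &
      forall A : set (borelC R), measurable A ->
        mu A = (\int[lebesgue_measure]_(t in @period R `&` (@expi R) @^-1` A)
                  (w t / (2 * pi))%:E + mus A)%E].

End Measures.

Section OrthogonalPolynomials.
Variable R : realType.
Variable mu : {measure set (borelC R) -> \bar R}.
Implicit Types (Phi : nat -> {poly R[i]}) (alpha : nat -> R[i]).

Definition Cintegral (f : R[i] -> R[i]) : R[i] :=
  Complex (\int[mu]_(z in @circle R) complex.Re (f z))
          (\int[mu]_(z in @circle R) complex.Im (f z)).

Definition inner (p q : {poly R[i]}) : R[i] :=
  Cintegral (fun z => (p.[z])^* * q.[z]).

Definition L2norm (p : {poly R[i]}) : R :=
  Num.sqrt (\int[mu]_(z in @circle R) (complex.Re `|p.[z]| ^+ 2)).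

Definition monic_OPs Phi : Prop :=
  forall n, [/\ Phi n \is monic, size (Phi n) = n.+1 &
             forall q : {poly R[i]}, (size q <= n)%N -> inner q (Phi n) = 0].

Definition normalized Phi (n : nat) : {poly R[i]} :=
  (real_complex R (L2norm (Phi n)))^-1 *: Phi n.

(* p^*(z) = z^n conj(p(1 / conj z)); meaningful for z != 0. *)
Definition reversed (n : nat) (p : {poly R[i]}) (z : R[i]) : R[i] :=
  z ^+ n * (p.[(z^*)^-1])^*.

(* Polynomials that agree at all z != 0 are equal. *)
Definition verblunsky Phi alpha : Prop :=
  forall n (z : R[i]), z != 0 ->
    (Phi n.+1).[z] = z * (Phi n).[z] - (alpha n)^* * reversed n (Phi n) z.

Definition rho alpha (n : nat) : R :=
  Num.sqrt (1 - complex.Re `|alpha n| ^+ 2).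

Definition CD_kernel Phi (n : nat) (z w : R[i]) : R[i] :=
  \sum_(j < n.+1) ((normalized Phi j).[z])^* * (normalized Phi j).[w].

(* K_n(z, z), as a real number. *)
Definition CD_diag Phi (n : nat) (z : R[i]) : R :=
  complex.Re (CD_kernel Phi n z z).

Definition regular_circle alpha : Prop :=
  (\prod_(1 <= j < n.+1) rho alpha j) `^ (n%:R^-1) @[n --> \oo] --> (1 : R).

End OrthogonalPolynomials.

(* Main.v *)
Require Import Defs.
From HB Require Import structures.
From mathcomp Require Import all_boot all_order all_algebra complex.
From mathcomp Require Import all_classical all_reals all_analysis.
From mathcomp Require Import measurable_realfun ring lra.

Import Order.TTheory GRing.Theory Num.Theory.
Import numFieldNormedType.Exports.

Local Open Scope classical_set_scope.
Local Open Scope ring_scope.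

Set Implicit Arguments.
Unset Strict Implicit.
Unset Printing Implicit Defensive.

(** Write [k_n] for the diagonal of the Christoffel-Darboux kernel divided by
    [n.+1], and [F_n] for the Fejer kernel. The measure [k_n mu] has total mass 1.
    Both conclusions follow from two one-sided facts: asymptotically, [k_n mu]
    gives an arc at most its normalized length ([integral_cd_mean_arc]), and on the
    arc [w * k_n] is at least 1, in the sense that the integral of the positive
    part of [1 - w * k_n] tends to zero ([defect_cvg]). Indeed the mass of the arc
    is the integral of [w * k_n] plus the singular mass, and [`|1 - x|] is
    [x - 1] plus twice the positive part of [1 - x]; nothing is then left for the
    singular mass, nor for the error in mean ([total_error_le]).

    Upper bound. The polynomials [z ^+ k * Phi m] and [Phi (k + m)] are monic of
    the same degree, so by Pythagoras the squared norm of their difference is the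
    loss [h m - h (k + m)], where [h] is the squared norm of [Phi]
    ([sqnorm_shift_error]). The recurrence identifies [h n.+1 / h n] with the
    square of [rho alpha n]; regularity says that [ln (h n)] is small with respect
    to [n], and the relative losses, being bounded by differences of logarithms,
    telescope and are small on average ([average_shift_loss]). Thus multiplication
    by [z] acts on most [Phi m] almost as the shift, and a unimodular combination
    of the first [N.+1] powers of [z] multiplies the norm almost as if its terms
    were orthogonal ([sqnorm_shift_sum]). For the sum in the Fejer kernel this says
    that the integral of [F_N] against [k_n mu] is at most about 1, uniformly in
    the centre ([integral_fejer_cd_mean]); integrating the centre over a small
    neighbourhood of the arc bounds the mass of the arc.

    Lower bound. By Christoffel's variational principle ([christoffel]), applied
    to the polynomial whose squared modulus is [F_n / n.+1], the value of [k_n] at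
    a point is at least the reciprocal of the Fejer mean of [mu] there
    ([christoffel_fejer]). The Fejer means of the density converge to it in mean
    ([fejer_osc_cvg]), and those of the singular part tend to zero in mean outside
    arbitrarily small sets ([fejer_singular_cvg]). As [w] is positive almost
    everywhere on the arc, it is bounded below off a small set, where the excess of
    the Fejer mean over [w] controls the defect ([defect_le]). *)

(** * The squared modulus and the topology of the complex plane *)

Section ComplexPlane.
Variable R : realType.
Implicit Types (z u v : R[i]) (t : R).

(** The squared modulus as an element of [R]; the norm of [R[i]] takes its
    values in [R[i]], over which nothing can be integrated. *)
Definition nsq z : R := complex.Re z ^+ 2 + complex.Im z ^+ 2.

Lemma nsqE z : (nsq z)%:C%C = `|z| ^+ 2.
Proof. by rewrite /nsq add_Re2_Im2. Qed.

Lemma conjCE z : z^* = conjc z. Proof. by []. Qed.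

Lemma ReM u v : complex.Re (u * v) =
  complex.Re u * complex.Re v - complex.Im u * complex.Im v.
Proof. by case: u v => [a b] [c d]. Qed.

Lemma ImM u v : complex.Im (u * v) =
  complex.Re u * complex.Im v + complex.Im u * complex.Re v.
Proof. by case: u v => [a b] [c d]. Qed.

Lemma ReD u v : complex.Re (u + v) = complex.Re u + complex.Re v.
Proof. by case: u v => [a b] [c d]. Qed.

Lemma ImD u v : complex.Im (u + v) = complex.Im u + complex.Im v.
Proof. by case: u v => [a b] [c d]. Qed.

Lemma ReN u : complex.Re (- u) = - complex.Re u.
Proof. by case: u => [a b]. Qed.

Lemma ImN u : complex.Im (- u) = - complex.Im u.
Proof. by case: u => [a b]. Qed.

Lemma ReJ u : complex.Re (u^*) = complex.Re u.
Proof. by case: u => [a b]. Qed.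

Lemma ImJ u : complex.Im (u^*) = - complex.Im u.
Proof. by case: u => [a b]. Qed.

Lemma cjM u v : (u * v)^* = u^* * v^*.
Proof. exact: (rmorphM (@conjc R)). Qed.

Lemma cjX u n : (u ^+ n)^* = (u^*) ^+ n.
Proof. exact: (rmorphXn (@conjc R)). Qed.

Lemma cjK u : (u^*)^* = u.
Proof. exact: conjcK. Qed.

Lemma cj_sum (I : Type) (r : seq I) (P : pred I) (F : I -> R[i]) :
  (\sum_(i <- r | P i) F i)^* = \sum_(i <- r | P i) (F i)^*.
Proof. exact: (raddf_sum (@conjc R)). Qed.

Lemma Re_sum (I : Type) (r : seq I) (P : pred I) (F : I -> R[i]) :
  complex.Re (\sum_(i <- r | P i) F i) = \sum_(i <- r | P i) complex.Re (F i).
Proof. by apply: (big_morph (@complex.Re R)) => //; exact: ReD. Qed.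

Definition ReIm := (ReD, ImD, ReN, ImN, ReM, ImM, ReJ, ImJ).

Lemma nsq_ge0 z : 0 <= nsq z.
Proof. by rewrite addr_ge0// sqr_ge0. Qed.

Lemma nsq0 : nsq 0 = 0.
Proof. by rewrite /nsq /= expr0n addr0. Qed.

Lemma nsqM u v : nsq (u * v) = nsq u * nsq v.
Proof. by rewrite /nsq !ReIm; ring. Qed.

Lemma nsqJ u : nsq (u^*) = nsq u.
Proof. by rewrite /nsq !ReIm sqrrN. Qed.

Lemma nsqN u : nsq (- u) = nsq u.
Proof. by rewrite /nsq !ReIm !sqrrN. Qed.

Lemma nsqX u n : nsq (u ^+ n) = nsq u ^+ n.
Proof.
elim: n => [|n IH]; first by rewrite !expr0 /nsq /= expr1n expr0n addr0.
by rewrite !exprS nsqM IH.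
Qed.

Lemma nsqR (x : R) : nsq (x%:C%C) = x ^+ 2.
Proof. by rewrite /nsq /= expr0n addr0. Qed.

Lemma Re_conjM z : complex.Re (z^* * z) = nsq z.
Proof. by rewrite /nsq !ReIm; ring. Qed.

Lemma mulCJ u : u * u^* = (nsq u)%:C%C.
Proof.
case: u => a b; apply/eqP; rewrite eq_complex /nsq /=.
by apply/andP; split; apply/eqP; ring.
Qed.

Lemma nsq_eq0 z : (nsq z == 0) = (z == 0).
Proof.
rewrite /nsq paddr_eq0 ?sqr_ge0// !sqrf_eq0.
by case: z => a b; rewrite eq_complex.
Qed.

Lemma nsq_gt0 z : (0 < nsq z) = (z != 0).
Proof. by rewrite lt_def nsq_ge0 andbT nsq_eq0. Qed.

Lemma circleP z : circle z <-> nsq z = 1.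
Proof.
rewrite /circle /=; split=> [h|h].
  have := nsqE z; rewrite h expr1n => -[]; by move=> ->.
have : `|z| ^+ 2 = 1 :> R[i] by rewrite -nsqE h.
by move/eqP; rewrite sqrp_eq1 ?normr_ge0// => /eqP.
Qed.

Lemma Re_norm2 z : complex.Re `|z| ^+ 2 = nsq z.
Proof. by rewrite normc_def /= sqr_sqrtr// addr_ge0// sqr_ge0. Qed.

(** The weight [c] lets a large multiple of a small error be paid for by an
    arbitrarily small increase of the main term. *)
Lemma nsqD_le (c : R) u v : 0 < c ->
  nsq (u + v) <= (1 + c) * nsq u + (1 + c^-1) * nsq v.
Proof.
move=> c0; rewrite /nsq !ReIm -subr_ge0.
set a := complex.Re u; set b := complex.Im u.
set a' := complex.Re v; set b' := complex.Im v.
have -> : (1 + c) * (a ^+ 2 + b ^+ 2) + (1 + c^-1) * (a' ^+ 2 + b' ^+ 2) -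
  ((a + a') ^+ 2 + (b + b') ^+ 2) =
  c * ((a - c^-1 * a') ^+ 2 + (b - c^-1 * b') ^+ 2).
  by field; rewrite gt_eqF.
by rewrite mulr_ge0// ?(ltW c0)// addr_ge0// sqr_ge0.
Qed.

Lemma nsq_sum_le n (F : 'I_n -> R[i]) :
  nsq (\sum_(j < n) F j) <= n%:R * \sum_(j < n) nsq (F j).
Proof.
elim: n F => [|n IH] F; first by rewrite !big_ord0 nsq0 mulr0.
rewrite !big_ord_recr /=.
set S := \sum_(i < n) _; set Q := \sum_(i < n) _.
have IH' : nsq S <= n%:R * Q by exact: IH.
have [n0|n0] := eqVneq n 0%N.
  have -> : S = 0 by apply: big1 => -[i ilt] _; exfalso; move: ilt; rewrite n0.
  rewrite add0r -[leLHS]mul1r ler_pM ?nsq_ge0// ?ler1n//.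
  by rewrite lerDr sumr_ge0// => i _; exact: nsq_ge0.
have n0' : (0 : R) < n%:R by rewrite ltr0n lt0n.
have V0 : (0 : R) < (n%:R)^-1 by rewrite invr_gt0.
apply: (le_trans (nsqD_le S (F ord_max) V0)).
move: (nsq_ge0 (F ord_max)); set q := nsq _ => q0.
rewrite invrK -natr1 [_ + 1]addrC [leRHS]mulrDr lerD2r.
have -> : (1 + n%:R) * Q = (1 + n%:R^-1) * (n%:R * Q).
  by field; rewrite gt_eqF.
by rewrite ler_pM2l// ltr_wpDl.
Qed.

Lemma ball_complexE (e : R[i]) (u v : R[i]^o) : 0 < e ->
  ball u e v <-> nsq (u - v) < complex.Re e ^+ 2.
Proof.
move=> e0; rewrite -ball_normE /ball_ /= normc_def.
have ee : e = (complex.Re e)%:C%C by rewrite RRe_real// gtr0_real.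
have e0' : 0 < complex.Re e by move: e0; rewrite {1}ee -[0]/(0%:C%C) ltcR.
rewrite [in X in X <-> _]ee ltcR -/(nsq _).
rewrite -[in X in X <-> _](@ltr_pXn2r _ 2%N)// ?nnegrE ?sqrtr_ge0 ?(ltW e0')//.
by rewrite sqr_sqrtr// nsq_ge0.
Qed.

Lemma open_complexP (U : set R[i]) :
  @open R[i]^o U <->
  forall z, U z -> exists2 d : R, 0 < d & forall v, nsq (z - v) < d -> U v.
Proof.
rewrite openE; split=> [oU z Uz|oU z Uz].
  have /nbhs_ballP[e /= e0 eU] := oU z Uz.
  have e0' : 0 < complex.Re e by rewrite -(ltcR 0) RRe_real// gtr0_real.
  exists (complex.Re e ^+ 2); first by rewrite exprn_gt0.
  by move=> v zv; apply: eU; apply/ball_complexE.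
have [d d0 dU] := oU z Uz.
apply/nbhs_ballP; exists (Num.sqrt d)%:C%C => /=.
  by rewrite ltcR sqrtr_gt0.
move=> v /= /ball_complexE zv; apply: dU.
by move: zv; rewrite sqr_sqrtr ?(ltW d0)//; apply; rewrite ltcR sqrtr_gt0.
Qed.

Lemma closed_sep (C : set R[i]) z : @closed R[i]^o C -> ~ C z ->
  exists2 d : R, 0 < d & forall c, C c -> d <= nsq (z - c).
Proof.
move=> cC nCz; have /open_complexP/(_ z nCz)[d d0 dC] := closed_openC cC.
exists d => // c Cc; rewrite leNgt; apply/negP => /dC; exact.
Qed.

Lemma nsq_continuous (f : R[i] -> R) :
  (forall z (e : R), 0 < e -> exists2 d : R, 0 < d &
     forall v, nsq (z - v) < d -> `|f z - f v| < e) ->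
  continuous (f : R[i]^o -> R).
Proof.
move=> h z; apply/(@cvgrPdist_lt _ _ _ _ (nbhs_filter (z : R[i]^o))) => e e0.
have [d d0 dh] := h z e e0.
apply/nbhs_ballP; exists (Num.sqrt d)%:C%C => /=.
  by rewrite ltcR sqrtr_gt0.
move=> v /= /ball_complexE zv; apply: dh.
by move: zv; rewrite sqr_sqrtr ?(ltW d0)//; apply; rewrite ltcR sqrtr_gt0.
Qed.

Lemma continuous_Re : continuous (@complex.Re R : R[i]^o -> R).
Proof.
apply: nsq_continuous => z e e0; exists (e ^+ 2); first by rewrite exprn_gt0.
move=> v; rewrite /nsq !ReIm => zv.
rewrite -(@ltr_pXn2r _ 2%N)// ?nnegrE ?(ltW e0)//.
rewrite real_normK ?num_real//; apply: le_lt_trans zv.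
by rewrite lerDl sqr_ge0.
Qed.

Lemma continuous_Im : continuous (@complex.Im R : R[i]^o -> R).
Proof.
apply: nsq_continuous => z e e0; exists (e ^+ 2); first by rewrite exprn_gt0.
move=> v; rewrite /nsq !ReIm => zv.
rewrite -(@ltr_pXn2r _ 2%N)// ?nnegrE ?(ltW e0)//.
rewrite real_normK ?num_real//; apply: le_lt_trans zv.
by rewrite lerDr sqr_ge0.
Qed.

Lemma open_borelC (A : set R[i]) : @open R[i]^o A -> measurable (A : set (borelC R)).
Proof. by move=> oA; apply: sub_sigma_algebra. Qed.

Lemma closed_borelC (A : set R[i]) :
  @closed R[i]^o A -> measurable (A : set (borelC R)).
Proof.
by move=> cA; rewrite -[A]setCK; apply: measurableC; apply: open_borelC; exact: closed_openC.
Qed.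

Lemma continuous_borelC (f : R[i] -> R) : continuous (f : R[i]^o -> R) ->
  measurable_fun setT (f : borelC R -> R).
Proof.
move=> cf; apply: (measurability _ (RGenOpens.measurableE R)) => _ [_ [a [b ->]] <-].
rewrite setTI; apply: open_borelC.
by have /continuousP := cf; apply; exact: interval_open.
Qed.

End ComplexPlane.

(** * The circle and its angles *)

Section UnitCircle.
Variable R : realType.
Implicit Types (z u v : R[i]) (s t : R).

Lemma nsq_expi t : nsq (expi t) = 1.
Proof. exact: cos2Dsin2. Qed.

Lemma circle_expi t : circle (expi t).
Proof. by apply/circleP; exact: nsq_expi. Qed.

Lemma expiD s t : expi (s + t) = expi s * expi t.
Proof.
apply/eqP; rewrite eq_complex /= cosD sinD eqxx /=.
by apply/eqP; ring.
Qed.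

Lemma expi0 : expi 0 = 1 :> R[i].
Proof. by rewrite /expi cos0 sin0. Qed.

Lemma expi2pi : expi (2 * pi) = 1 :> R[i].
Proof. by rewrite /expi mulr_natl cos2pi sin2pi. Qed.

Lemma expiN t : expi (- t) = (expi t)^*.
Proof. by rewrite /expi cosN sinN. Qed.

Lemma nsq_expiB s t : nsq (expi s - expi t) = 2 - 2 * cos (s - t).
Proof.
rewrite /nsq !ReIm /= cosB.
have := cos2Dsin2 s; have := cos2Dsin2 t.
set a := cos s; set b := sin s; set c := cos t; set d := sin t => h1 h2.
have -> : (a - c) ^+ 2 + (b - d) ^+ 2 =
  (a ^+ 2 + b ^+ 2) + (c ^+ 2 + d ^+ 2) - 2 * (a * c + b * d) by ring.
by rewrite h1 h2; ring.
Qed.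

Lemma cos_lt1 t : 0 < t < 2 * pi -> cos t < 1.
Proof.
move=> /andP[t0 t2].
have -> : t = (t / 2) *+ 2 by rewrite -mulr_natr -mulrA mulVf ?mulr1// pnatr_eq0.
have : 0 < sin (t / 2).
  apply: sin_gt0_pi; rewrite divr_gt0//= ltr_pdivrMr//.
  by rewrite mulrC.
move=> s0; rewrite cos_mulr2n cos2sin2 -subr_gt0.
set x := sin _ in s0 *.
have -> : 1 - ((1 - x ^+ 2) *+ 2 - 1) = x ^+ 2 *+ 2 by ring.
by rewrite pmulrn_lgt0// exprn_gt0.
Qed.

Lemma expi_inj : {in @period R &, injective (@expi R)}.
Proof.
suff H s t : @period R s -> @period R t -> s < t -> expi s <> expi t.
  move=> s t; rewrite !inE => ps pt e.
  case: (ltgtP s t) => // st; first by case: (H s t ps pt st).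
  by case: (H t s pt ps st).
rewrite /period /= !in_itv /= => /andP[s0 s2] /andP[t0 t2] st e.
have : nsq (expi t - expi s) = 0 by rewrite e subrr nsq0.
rewrite nsq_expiB.
have := @cos_lt1 (t - s); rewrite subr_gt0 st /=.
rewrite (_ : t - s < 2 * pi); last by lra.
by move=> /(_ isT); lra.
Qed.

Lemma expi_surj z : circle z -> exists2 t, @period R t & expi t = z.
Proof.
case: z => a b /circleP; rewrite /nsq /= => ab.
have a2 : a ^+ 2 <= 1 by rewrite -ab lerDl sqr_ge0.
have a11 : -1 <= a <= 1.
  by rewrite -ler_norml -(@ler_pXn2r _ 2%N)// ?nnegrE// expr1n real_normK ?num_real.
have ca : cos (acos a) = a by apply: acosK; rewrite in_itv.
have pi0 := @pi_gt0 R.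
have sa : sin (acos a) = `|b|.
  rewrite sin_acos// -sqrtr_sqr; congr Num.sqrt; lra.
have [b0|b0] := leP 0 b.
  exists (acos a); last by rewrite /expi ca sa ger0_norm.
  rewrite /period /= in_itv /= acos_ge0//=.
  by apply: (le_lt_trans (acos_lepi a11)); lra.
exists (2 * pi - acos a).
  rewrite /period /= in_itv /=.
  have a1 : a < 1.
    rewrite lt_neqAle (andP a11).2 andbT; apply/eqP => a1.
    by have : 0 < b ^+ 2; [rewrite exprn_even_gt0//= lt_eqF | rewrite a1 in ab; lra].
  have := @acos_gt0 _ a; rewrite a1 (andP a11).1 => /(_ isT).
  have := acos_lepi a11.
  by move=> h1 h2; apply/andP; split; lra.
rewrite expiD expi2pi mul1r expiN /expi ca sa ltr0_norm//.
by rewrite conjCE /= opprK.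
Qed.

Lemma expi_cts : continuous (@expi R : R -> R[i]^o).
Proof.
move=> t; apply/(@cvgrPdist_lt _ _ _ _ (nbhs_filter t)) => e e0.
have e0' : 0 < complex.Re e by rewrite -(ltcR 0) RRe_real// gtr0_real.
have H : \forall s \near t, 2 - 2 * cos (t - s) < complex.Re e ^+ 2.
  have /cvgrPdist_lt/(_ (complex.Re e ^+ 2 / 2)) : cos (t - s) @[s --> t] --> cos 0.
    apply: continuous_cvg; first exact: continuous_cos.
    by rewrite -[X in _ --> X](subrr t); apply: cvgB; [exact: cvg_cst|exact: cvg_id].
  rewrite divr_gt0 ?exprn_gt0// => /(_ isT); apply: filterS => s.
  rewrite cos0 ger0_norm ?subr_ge0 ?cos_le1// ltr_pdivlMr//; lra.
apply: filterS H => s; rewrite -nsq_expiB => h.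
have /(@ball_complexE _ e (expi t) (expi s) e0) := h.
by rewrite -ball_normE.
Qed.

Lemma measurable_expi : measurable_fun setT (@expi R : R -> borelC R).
Proof.
apply: (@measurability _ _ (measurableTypeR R) (borelC R) setT (@expi R)
  (@open R[i]^o) (erefl _)) => _ [U oU <-].
rewrite setTI; apply: open_measurable.
by have /continuousP := expi_cts; apply.
Qed.

Lemma closed_expi (C : set R) : compact C -> @closed R[i]^o (@expi R @` C).
Proof.
move=> cC; apply: compact_closed; first exact: norm_hausdorff.
by apply: continuous_compact => //; apply: continuous_subspaceT; exact: expi_cts.
Qed.

Lemma expi_itv (a : R) : @circle R `<=` @expi R @` `[a, a + 2 * pi].
Proof.
move=> z cz; have /circleP := cz => z1.
have : circle (z * (expi a)^*) by apply/circleP; rewrite nsqM z1 nsqJ nsq_expi mulr1.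
move=> /expi_surj[s]; rewrite /period /= in_itv /= => /andP[s0 s2] sE.
exists (a + s).
  by rewrite /= in_itv /= lerDl s0 /= lerD2l ltW.
rewrite expiD sE mulrC -mulrA -expiN -expiD addNr expi0 mulr1//.
Qed.

Lemma closed_circle : @closed R[i]^o (@circle R).
Proof.
rewrite (_ : @circle R = @expi R @` `[0, 0 + 2 * pi]); last first.
  apply/seteqP; split; first exact: expi_itv.
  by move=> _ [t _ <-]; exact: circle_expi.
by apply: closed_expi; exact: segment_compact.
Qed.

Lemma measurable_circle : measurable (@circle R : set (borelC R)).
Proof. by apply: closed_borelC; exact: closed_circle. Qed.

(** Passing to the closure of an arc adds at most its two end points, hence no
    length; an unbounded interval of angles covers the whole circle. *)
Lemma arc_hull (J : interval R) : exists C : set R[i],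
  [/\ @closed R[i]^o C, circle_arc J `<=` C & finite_set (C `\` circle_arc J)].
Proof.
have full a : `[a, a + 2 * pi] `<=` [set` J] -> exists C : set R[i],
  [/\ @closed R[i]^o C, circle_arc J `<=` C & finite_set (C `\` circle_arc J)].
  move=> aJ; exists (@circle R); split; first exact: closed_circle.
    by move=> _ [t _ <-]; exact: circle_expi.
  rewrite (_ : _ `\` _ = set0)//; apply/seteqP; split => // z [cz]; apply.
  by have [t /aJ tJ <-] := expi_itv a cz; exists t.
have empty : [set` J] = set0 -> exists C : set R[i],
  [/\ @closed R[i]^o C, circle_arc J `<=` C & finite_set (C `\` circle_arc J)].
  move=> J0; exists set0; split; first exact: closed0.
    by move=> z [t]; rewrite J0.
  by rewrite set0D.
have pi0 := @pi_gt0 R.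
case: J full empty => [[x a|[]] [y b|[]]] full empty.
- exists (@expi R @` `[a, b]); split.
  + by apply: closed_expi; exact: segment_compact.
  + move=> z [t /=]; rewrite in_itv /= => /andP[h1 h2] <-{z}; exists t => //=.
    by rewrite in_itv /= (lteifW h1) (lteifW h2).
  + apply: (@sub_finite_set _ _ [set expi a; expi b]) => //.
    move=> z [[t /=]] ; rewrite in_itv /= => /andP[h1 h2] <-{z} nt.
    have [->|na] := eqVneq t a; first by left.
    have [->|nb] := eqVneq t b; first by right.
    exfalso; apply: nt; exists t => //=; rewrite in_itv /=.
    by apply/andP; split; apply: lteifS; rewrite lt_neqAle; apply/andP; split;
      rewrite // eq_sym.
- by apply: empty; apply/seteqP; split => t //=; rewrite in_itv /= andbF.
- apply: (full (a + 1)) => t /=; rewrite !in_itv /= andbT => /andP[ta _].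
  by apply: lteifS; apply: lt_le_trans ta; rewrite ltrDl.
- apply: (full (b - 1 - 2 * pi)) => t /=; rewrite !in_itv /= => /andP[_ ta].
  by apply: lteifS; apply: (le_lt_trans ta); rewrite subrK; lra.
- by apply: empty; apply/seteqP; split => t.
- by apply: (full 0) => t.
- by apply: empty; apply/seteqP; split => t.
- by apply: empty; apply/seteqP; split => t.
- by apply: empty; apply/seteqP; split => t.
Qed.

Lemma closed_finite (A : set R[i]) : finite_set A -> @closed R[i]^o A.
Proof.
have /accessible_finite_set_closed : accessible_space R[i]^o.
  by apply: hausdorff_accessible; exact: norm_hausdorff.
exact.
Qed.

Lemma measurable_arc (J : interval R) : measurable (circle_arc J : set (borelC R)).
Proof.
have [C [cC sC fC]] := arc_hull J.
have -> : circle_arc J = C `\` (C `\` circle_arc J) by rewrite setDD setIC setIidl.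
by apply: measurableD; apply: closed_borelC => //; exact: closed_finite.
Qed.

Lemma lebesgue_finite_angles (A : set R[i]) : finite_set A ->
  lebesgue_measure (@period R `&` (@expi R) @^-1` A) = 0%E.
Proof.
move=> fA; apply: countable_lebesgue_measure0; apply: finite_set_countable.
pose g z := xget 0 [set t | @period R t /\ expi t = z].
apply: (sub_finite_set _ (finite_image g fA)) => t [pt At]; exists (expi t) => //.
have [ps e] : [set s | @period R s /\ expi s = expi t] (g (expi t)).
  by apply: (@xgetPex _ 0); exists t.
by apply: expi_inj; rewrite ?inE.
Qed.

(** The angles outside [U] form a compact set whose image avoids the point. The
    hypothesis at [t = 0] is there because both ends of the period name the same
    point of the circle. *)
Lemma expi_sep (U : set R) t : open U -> @period R t -> U t ->
  (t = 0 -> U (2 * pi)) ->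
  exists2 d : R, 0 < d & forall s, @period R s -> ~ U s -> d <= nsq (expi t - expi s).
Proof.
move=> oU pt Ut U0.
have cC : compact (`[0, 2 * pi] `&` ~` U).
  apply: (@subclosed_compact _ _ `[0, 2 * pi]).
  - by apply: closedI; [exact: interval_closed|exact: open_closedC].
  - exact: segment_compact.
  - exact: subIsetl.
have [|d d0 dC] := @closed_sep R _ (expi t) (closed_expi cC).
  move=> [s [/= ]]; rewrite in_itv /= => /andP[s0 s2] nUs e.
  have [s2'|s2'] := eqVneq s (2 * pi).
    apply: nUs; rewrite s2'; apply: U0.
    apply: expi_inj; rewrite ?inE// ?expi0 -?e ?s2' ?expi2pi//.
    by rewrite /period /= in_itv /= lexx mulr_gt0// pi_gt0.
  apply: nUs; rewrite (_ : s = t)//; apply: expi_inj; rewrite ?inE//.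
  by rewrite /period /= in_itv /= s0 lt_neqAle s2' s2.
exists d => // s ps nUs; apply: dC; exists s => //; split => //.
by move: ps; rewrite /period /= !in_itv /= => /andP[-> /ltW ->].
Qed.

End UnitCircle.

(** * Complex-valued measurable functions and the Fejer kernel *)

Section ComplexMeasurability.
Context d (T : measurableType d) (R : realType).
Implicit Types f g : T -> R[i].

Definition measurable_complex f :=
  measurable_fun setT (fun x => complex.Re (f x)) /\
  measurable_fun setT (fun x => complex.Im (f x)).

Lemma mcplx_cst (c : R[i]) : measurable_complex (fun=> c).
Proof. by split; exact: measurable_cst. Qed.

Lemma mcplxD f g : measurable_complex f -> measurable_complex g ->
  measurable_complex (fun x => f x + g x).
Proof.
move=> [f1 f2] [g1 g2]; split.
- by under eq_fun do rewrite ReD; exact: measurable_funD.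
- by under eq_fun do rewrite ImD; exact: measurable_funD.
Qed.

Lemma mcplxM f g : measurable_complex f -> measurable_complex g ->
  measurable_complex (fun x => f x * g x).
Proof.
move=> [f1 f2] [g1 g2]; split.
- by under eq_fun do rewrite ReM; apply: measurable_funB; exact: measurable_funM.
- by under eq_fun do rewrite ImM; apply: measurable_funD; exact: measurable_funM.
Qed.

Lemma mcplxJ f : measurable_complex f -> measurable_complex (fun x => (f x)^*).
Proof.
move=> [f1 f2]; split.
- by under eq_fun do rewrite ReJ.
- by under eq_fun do rewrite ImJ; exact: measurableT_comp.
Qed.

Lemma mcplxX f n : measurable_complex f -> measurable_complex (fun x => f x ^+ n).
Proof.
move=> mf; elim: n => [|n IH].
  by under eq_fun do rewrite expr0; exact: mcplx_cst.
by under eq_fun do rewrite exprS; exact: mcplxM.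
Qed.

Lemma mcplx_sum (I : Type) (r : seq I) (F : I -> T -> R[i]) :
  (forall i, measurable_complex (F i)) ->
  measurable_complex (fun x => \sum_(i <- r) F i x).
Proof.
move=> mF; elim: r => [|i r IH].
  by under eq_fun do rewrite big_nil; exact: mcplx_cst.
by under eq_fun do rewrite big_cons; exact: mcplxD.
Qed.

Lemma mcplx_horner (p : {poly R[i]}) f : measurable_complex f ->
  measurable_complex (fun x => p.[f x]).
Proof.
move=> mf; under eq_fun do rewrite horner_coef.
by apply: mcplx_sum => i; apply: mcplxM; [exact: mcplx_cst|exact: mcplxX].
Qed.

Lemma measurable_nsq f : measurable_complex f ->
  measurable_fun setT (fun x => nsq (f x)).
Proof. by move=> [f1 f2]; apply: measurable_funD; exact: measurable_funX. Qed.

End ComplexMeasurability.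

Section FejerKernel.
Variable R : realType.
Implicit Types (z u v : R[i]) (s t : R).

Lemma mcplx_id : measurable_complex (fun z : borelC R => z).
Proof.
by split; apply: continuous_borelC; [exact: continuous_Re|exact: continuous_Im].
Qed.

Lemma mcplx_expi : measurable_complex (@expi R : R -> R[i]).
Proof.
by split; [exact: (continuous_measurable_fun (@continuous_cos R))
          |exact: (continuous_measurable_fun (@continuous_sin R))].
Qed.

Lemma mcplx_comp d1 d2 (T1 : measurableType d1) (T2 : measurableType d2)
    (g : T1 -> T2) (f : T2 -> R[i]) :
  measurable_fun setT g -> measurable_complex f -> measurable_complex (fun x => f (g x)).
Proof.
move=> mg [f1 f2].
by split; [exact: (measurableT_comp f1 mg)|exact: (measurableT_comp f2 mg)].
Qed.

(** On the unit circle this is the Fejer kernel at the quotient of the two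
    points. *)
Definition fejer n z u : R := nsq (\sum_(j < n.+1) (z * u^*) ^+ j) / n.+1%:R.

Lemma fejer_ge0 n z u : 0 <= fejer n z u.
Proof. by rewrite divr_ge0// nsq_ge0. Qed.

Lemma fejerC n z u : fejer n z u = fejer n u z.
Proof.
rewrite /fejer -nsqJ cj_sum; congr (nsq _ / _).
by apply: eq_bigr => j _; rewrite cjX cjM cjK mulrC.
Qed.

Lemma measurable_fejer d (T : measurableType d) n (f g : T -> R[i]) :
  measurable_complex f -> measurable_complex g ->
  measurable_fun setT (fun x => fejer n (f x) (g x)).
Proof.
move=> mf mg; apply: measurable_funM; last exact: measurable_cst.
apply: measurable_nsq; apply: mcplx_sum => j; apply: mcplxX; apply: mcplxM => //.
exact: mcplxJ.
Qed.

(** With [v = z * u^*], [1 - v] times the geometric sum is [1 - v ^+ n.+1], whose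
    squared modulus is at most 4. *)
Lemma fejer_le n z u (d : R) : nsq z = 1 -> nsq u = 1 -> 0 < d ->
  d <= nsq (z - u) -> fejer n z u <= 4 / (n.+1%:R * d).
Proof.
move=> z1 u1 d0 dzu; rewrite /fejer; set v := z * u^*; set S := \sum_(j < _) _.
have dv : nsq (1 - v) = nsq (z - u).
  have e : (z - u) * u^* = - (1 - v).
    rewrite mulrBl opprB; congr (_ - _).
    by rewrite mulCJ u1.
  have <- : nsq (z - u) * nsq (u^*) = nsq (z - u) by rewrite nsqJ u1 mulr1.
  by rewrite -nsqM e nsqN.
have v1 : nsq v = 1 by rewrite nsqM nsqJ z1 u1 mulr1.
have geo : (1 - v) * S = 1 - v ^+ n.+1.
  rewrite -[in RHS](expr1n _ n.+1) subrXX; congr (_ * _).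
  by apply: eq_bigr => i _; rewrite expr1n mul1r.
have le4 : nsq (1 - v) * nsq S <= 4.
  rewrite -nsqM geo; apply: (le_trans (nsqD_le _ _ ltr01)).
  rewrite nsqN nsqX v1 expr1n invr1 /nsq /= expr1n expr0n /=; lra.
rewrite invfM mulrCA [leLHS]mulrC ler_pM2l ?invr_gt0 ?ltr0n//.
rewrite ler_pdivlMr//; apply: le_trans le4.
by rewrite mulrC ler_wpM2r ?nsq_ge0// dv.
Qed.

Lemma expiMn n t : expi (n%:R * t) = expi t ^+ n.
Proof.
elim: n => [|n IH]; first by rewrite mul0r expi0 expr0.
by rewrite exprS -natr1 mulrDl mul1r expiD IH mulrC.
Qed.

Lemma fejer_expiE n s t : fejer n (expi s) (expi t) =
  (\sum_(j < n.+1) \sum_(k < n.+1) cos ((j%:R - k%:R) * (s - t))) / n.+1%:R.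
Proof.
rewrite /fejer -Re_conjM; congr (_ / _).
rewrite cj_sum mulr_suml Re_sum; apply: eq_bigr => j _.
rewrite mulr_sumr Re_sum; apply: eq_bigr => k _.
rewrite -expiN -expiD -!expiMn -expiN -expiD.
by rewrite -cosN /=; congr cos; ring.
Qed.

(** Antiderivative, in the second angle, of one term of the kernel expanded into
    cosines; only the diagonal terms fail to be periodic. *)
Definition fejer_primitive_term n s (j k : 'I_n) t : R :=
  if j == k then t else - ((j%:R - k%:R)^-1 * sin ((j%:R - k%:R) * (s - t))).

Definition fejer_primitive n s t : R :=
  n.+1%:R^-1 * \sum_(j < n.+1) \sum_(k < n.+1) fejer_primitive_term s j k t.

Lemma is_derive_fejer_term n s (j k : 'I_n) t :
  is_derive t 1 (fejer_primitive_term s j k) (cos ((j%:R - k%:R) * (s - t))).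
Proof.
rewrite /fejer_primitive_term; case: (eqVneq j k) => [->|jk].
  by rewrite subrr mul0r cos0; exact: is_derive_id.
have m0 : (j%:R - k%:R : R) != 0.
  by rewrite subr_eq0 eqr_nat; apply: contra jk.
set m := (_ - _) in m0 *.
have h : is_derive t 1 (fun x : R => m * (s - x)) (- m).
  have -> : (fun x : R => m * (s - x)) = m *: (cst s - id).
    by apply/funext => x /=.
  by apply: is_derive_eq; rewrite /GRing.scale /=; ring.
have h2 := @is_derive1_comp _ sin _ t _ _ (is_derive_sin _) h.
have -> : (fun x => - (m^-1 * sin (m * (s - x)))) =
    - (m^-1 *: (sin \o (fun x : R => m * (s - x)))).
  by apply/funext => x /=.
by apply: is_derive_eq; rewrite /GRing.scale /=; field.
Qed.

Lemma is_derive_fejer n s t :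
  is_derive t 1 (fejer_primitive n s) (fejer n (expi s) (expi t)).
Proof.
rewrite fejer_expiE mulrC.
have -> : fejer_primitive n s =
    n.+1%:R^-1 *: \sum_(j < n.+1) \sum_(k < n.+1) fejer_primitive_term s j k.
  apply/funext => x; rewrite /fejer_primitive /= fct_sumE; congr (_ * _).
  by apply: eq_bigr => j _; rewrite fct_sumE.
have h j : is_derive t 1 (\sum_(k < n.+1) fejer_primitive_term s j k)
    (\sum_(k < n.+1) cos ((j%:R - k%:R) * (s - t))).
  by apply: is_derive_sum => k; exact: is_derive_fejer_term.
apply: is_deriveZ; apply: is_derive_sum => j; exact: h.
Qed.

Lemma fejer_primitive_period n s :
  fejer_primitive n s (2 * pi) = fejer_primitive n s 0 + 2 * pi.
Proof.
rewrite /fejer_primitive.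
have H (j : 'I_n.+1) : \sum_(k < n.+1) fejer_primitive_term s j k (2 * pi) =
    \sum_(k < n.+1) fejer_primitive_term s j k 0 + 2 * pi.
  rewrite (bigD1 j)//= [in RHS](bigD1 j)//= /fejer_primitive_term eqxx add0r addrC.
  congr (_ + _); apply: eq_bigr => k kj; rewrite eq_sym (negbTE kj).
  congr (- (_ * _)); rewrite subr0.
  have sinE (x : R) : sin ((j%:R - k%:R) * x) = complex.Im (expi x ^+ j * (expi x ^+ k)^*).
    by rewrite -(expiMn j x) -(expiMn k x) -expiN -expiD /=; congr sin; ring.
  have per : expi (s - 2 * pi) = expi s.
    by rewrite -[in RHS](subrK (2 * pi) s) [RHS]expiD expi2pi mulr1.
  by rewrite !sinE per.
under eq_bigr do rewrite H.
rewrite big_split /= sumr_const card_ord mulrDr; congr (_ + _).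
by rewrite -[2 * pi *+ n.+1]mulr_natr mulrCA mulVf ?mulr1// pnatr_eq0.
Qed.

(** Over a period, only the linear part of the antiderivative contributes. *)
Lemma integral_fejer n z : circle z ->
  (\int[lebesgue_measure]_(t in @period R) (fejer n z (expi t))%:E = (2 * pi)%:E)%E.
Proof.
move=> /expi_surj[s _ <-].
have mF : measurable_fun setT (fun t : R => fejer n (expi s) (expi t)).
  by apply: measurable_fejer; [exact: mcplx_cst|exact: mcplx_expi].
rewrite /period integral_itv_bndo_bndc; last first.
  by apply/measurable_EFinP; exact: measurable_funTS mF.
rewrite (@continuous_FTC2 _ _ (fejer_primitive n s)).
- by rewrite -EFinB fejer_primitive_period; congr EFin; ring.
- by rewrite mulr_gt0// pi_gt0.
- apply: continuous_subspaceT => t.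
  have -> : (fun t : R => fejer n (expi s) (expi t)) = (fun t =>
    (\sum_(j < n.+1) \sum_(k < n.+1) cos ((j%:R - k%:R) * (s - t))) / n.+1%:R).
    by apply/funext => x; exact: fejer_expiE.
  apply: cvgMl; apply: continuous_big => [|j _].
    exact: add_continuous.
  apply: continuous_big => [|k _ x]; first exact: add_continuous.
  apply: continuous_comp; last exact: continuous_cos.
  by apply: cvgMr; apply: cvgB; [exact: cvg_cst|exact: cvg_id].
- split.
  + by move=> t _; have [] := is_derive_fejer n s t.
  + apply: cvg_at_right_filter; apply: differentiable_continuous; apply/derivable1_diffP.
    by have [] := is_derive_fejer n s 0.
  + apply: cvg_at_left_filter; apply: differentiable_continuous; apply/derivable1_diffP.
    by have [] := is_derive_fejer n s (2 * pi).
- by move=> t _; rewrite derive1E; have := is_derive_fejer n s t => h; rewrite derive_val.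
Qed.

End FejerKernel.

(** * Tonelli on subsets and integration against the decomposed measure *)

Section TonelliOnSets.
Context d1 d2 (T1 : measurableType d1) (T2 : measurableType d2) (R : realType).
Variable m1 : {sigma_finite_measure set T1 -> \bar R}.
Variable m2 : {sigma_finite_measure set T2 -> \bar R}.
Variables (D1 : set T1) (D2 : set T2).
Hypotheses (mD1 : measurable D1) (mD2 : measurable D2).
Variable f : T1 * T2 -> R.
Hypothesis mf : measurable_fun setT f.
Hypothesis f0 : forall x, 0 <= f x.
Local Open Scope ereal_scope.

Let g : T1 * T2 -> \bar R := (EFin \o f) \_ (D1 `*` D2).

Let mg : measurable_fun setT g.
Proof.
apply/(measurable_restrictT _ _).1; first exact: measurableX.
by apply: measurable_funTS; exact/measurable_EFinP.
Qed.

Let g0 x : 0 <= g x.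
Proof. by rewrite /g patchE; case: ifPn => // _; rewrite lee_fin. Qed.

Let f2 := fun x => \int[m2]_(y in D2) (f (x, y))%:E.
Let f1 := fun y => \int[m1]_(x in D1) (f (x, y))%:E.

Let gE2 : fubini_F m2 g = f2 \_ D1.
Proof.
apply/funext => x; rewrite /fubini_F patchE /f2; case: ifPn => xD.
  rewrite [RHS]integral_mkcond; apply: eq_integral => y _.
  by rewrite /g !patchE in_setX /= xD.
by apply: integral0_eq => y _; rewrite /g patchE in_setX /= (negbTE xD).
Qed.

Let gE1 : fubini_G m1 g = f1 \_ D2.
Proof.
apply/funext => y; rewrite /fubini_G patchE /f1; case: ifPn => yD.
  rewrite [RHS]integral_mkcond; apply: eq_integral => x _.
  by rewrite /g !patchE in_setX /= yD andbT.
by apply: integral0_eq => x _; rewrite /g patchE in_setX /= (negbTE yD) andbF.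
Qed.

Lemma tonelli_in : \int[m1]_(x in D1) \int[m2]_(y in D2) (f (x, y))%:E =
  \int[m2]_(y in D2) \int[m1]_(x in D1) (f (x, y))%:E.
Proof.
have : \int[m1]_x fubini_F m2 g x = \int[m2]_y fubini_G m1 g y.
  exact: (fubini_tonelli g mg g0).
by rewrite gE2 gE1 -!integral_mkcond.
Qed.

Lemma measurable_integral_l : measurable_fun D2 f1.
Proof.
apply/(measurable_restrictT _ _).2 => //; rewrite -gE1.
exact: measurable_fun_fubini_tonelli_G.
Qed.

Lemma measurable_integral_r : measurable_fun D1 f2.
Proof.
apply/(measurable_restrictT _ _).2 => //; rewrite -gE2.
exact: measurable_fun_fubini_tonelli_F.
Qed.

End TonelliOnSets.

Section Decomposition.
Variable R : realType.
Variables (mu mus : {measure set (borelC R) -> \bar R}) (w : R -> R).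
Hypothesis dec : lebesgue_decomposition mu w mus.
Local Open Scope ereal_scope.
Import HBNNSimple.

Let mP : measurable (@period R).
Proof. exact: measurable_itv. Qed.

Let mem_angles t (A : set (borelC R)) :
  (t \in (@expi R) @^-1` A) = (expi t \in A).
Proof. by apply/idP/idP; rewrite !inE. Qed.

Let W (t : R) : \bar R := (w t / (2 * pi))%:E.

Let W0 t : period t -> 0 <= W t.
Proof.
case: dec => _ w0 _ _ pt; rewrite /W lee_fin divr_ge0 ?w0//.
by rewrite mulr_ge0// pi_ge0.
Qed.

Let mW : measurable_fun (@period R) W.
Proof.
case: dec => mw _ _ _; apply/measurable_EFinP; apply: measurable_funM => //.
Qed.

Let mcomp (g : borelC R -> \bar R) : measurable_fun setT g ->
  measurable_fun (@period R) (fun t => g (expi t) * W t).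
Proof.
move=> mg; apply: emeasurable_funM => //.
by apply: measurable_funTS; exact: (measurableT_comp mg (@measurable_expi R)).
Qed.

Let dec_indic (r : R) (A : set (borelC R)) : measurable A -> (0 <= r)%R ->
  \int[mu]_z (r * \1_A z)%:E =
  \int[lebesgue_measure]_(t in @period R) ((r * \1_A (expi t))%:E * W t) +
  \int[mus]_z (r * \1_A z)%:E.
Proof.
move=> mA r0; case: dec => _ _ _ muE.
have scale (m : {measure set (borelC R) -> \bar R}) :
    \int[m]_z (r * \1_A z)%:E = r%:E * m A.
  under eq_integral do rewrite EFinM.
  rewrite ge0_integralZl_EFin//; last exact/measurable_EFinP.
  by rewrite integral_indic// setIT.
rewrite !scale muE// ge0_muleDr//; last first.
  by apply: integral_ge0 => t [pt _]; exact: W0.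
congr (_ + _); rewrite integral_mkcondr -ge0_integralZl_EFin//.
- apply: eq_integral => t _; rewrite patchE indicE mem_angles.
  by case: ifP => _; rewrite ?mulr1// mulr0 mul0e mule0.
- move=> t pt; rewrite patchE; case: ifP => // _; exact: W0.
- apply/(measurable_restrict _ _ _).1 => //.
    by rewrite -[X in measurable X]setTI; exact: measurable_expi.
  by apply: measurable_funS mW => //; exact: subIsetl.
Qed.

Let dec_nnsfun (f : {nnsfun (borelC R) >-> R}) :
  \int[mu]_z (f z)%:E =
  \int[lebesgue_measure]_(t in @period R) ((f (expi t))%:E * W t) +
  \int[mus]_z (f z)%:E.
Proof.
have m1 r : measurable_fun setT (fun z : borelC R => (r * \1_(f @^-1` [set r]) z)%:E).
  by apply/measurable_EFinP; exact: measurableT_comp.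
have sumE (m : {measure set (borelC R) -> \bar R}) : \int[m]_z (f z)%:E =
    \sum_(r \in range f) \int[m]_z (r * \1_(f @^-1` [set r]) z)%:E.
  under [LHS]eq_integral do rewrite fimfunE -fsumEFin//.
  by rewrite [LHS]ge0_integral_fsum// => r z _; rewrite EFinM nnfun_muleindic_ge0.
rewrite !sumE.
under [X in _ = X + _]eq_integral.
  move=> t _; rewrite fimfunE -fsumEFin// ge0_mule_fsuml; last first.
    by move=> r; rewrite EFinM nnfun_muleindic_ge0.
  over.
rewrite ge0_integral_fsum//; last 2 first.
- by move=> r; exact: (mcomp (m1 r)).
- by move=> r t pt; rewrite mule_ge0 ?W0// EFinM nnfun_muleindic_ge0.
rewrite -fsbig_split//=; apply: eq_fsbigr => r; rewrite inE => -[z _ <-].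
by apply: dec_indic => //; exact: fun_ge0.
Qed.

(** From indicators to simple functions, and then to their monotone limits. *)
Lemma integral_decomposition (f : borelC R -> \bar R) :
  measurable_fun setT f -> (forall z, 0 <= f z) ->
  \int[mu]_z f z =
  \int[lebesgue_measure]_(t in @period R) (f (expi t) * W t) + \int[mus]_z f z.
Proof.
move=> mf f0; pose h := nnsfun_approx measurableT mf.
have lim (m : {measure set (borelC R) -> \bar R}) :
    (\int[m]_z (h n z)%:E @[n --> \oo] --> \int[m]_z f z).
  rewrite [X in _ --> X](_ : _ = \int[m]_z limn (fun n => (h n z)%:E)); last first.
    by apply: eq_integral => z _; apply/esym/cvg_lim => //; exact: cvg_nnsfun_approx.
  apply: cvg_monotone_convergence => //.
  - by move=> n; exact/measurable_EFinP.
  - by move=> n z _; rewrite lee_fin.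
  - by move=> z _ a b ab; rewrite lee_fin; exact/lefP/nd_nnsfun_approx.
have limW : \int[lebesgue_measure]_(t in @period R) ((h n (expi t))%:E * W t)
    @[n --> \oo] --> \int[lebesgue_measure]_(t in @period R) (f (expi t) * W t).
  rewrite [X in _ --> X](_ : _ = \int[lebesgue_measure]_(t in @period R)
      limn (fun n => (h n (expi t))%:E * W t)); last first.
    apply: eq_integral => t _; apply/esym/cvg_lim => //.
    by apply: cvgeZr => //; exact: cvg_nnsfun_approx.
  apply: cvg_monotone_convergence => //.
  - by move=> n; apply: (mcomp (g := EFin \o h n)); exact/measurable_EFinP.
  - by move=> n t pt; rewrite mule_ge0 ?W0// lee_fin.
  - move=> t pt a b ab; rewrite lee_wpmul2r ?W0//.
    have := nd_nnsfun_approx measurableT mf ab; rewrite -/h => /lefP hab.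
    by rewrite lee_fin; exact: hab.
suff : \int[mu]_z (h n z)%:E @[n --> \oo] -->
    \int[lebesgue_measure]_(t in @period R) (f (expi t) * W t) + \int[mus]_z f z.
  by apply: (cvg_unique _ (lim mu)).
rewrite (_ : (fun n => _) = (fun n =>
  \int[lebesgue_measure]_(t in @period R) ((h n (expi t))%:E * W t) +
  \int[mus]_z (h n z)%:E)); last by apply/funext => n; exact: dec_nnsfun.
apply: cvgeD => //.
rewrite ge0_adde_def// inE integral_ge0// => t pt.
by rewrite mule_ge0 ?W0.
Qed.

Lemma integral_decomposition_in (D : set (borelC R)) (f : borelC R -> R) :
  measurable D -> measurable_fun setT f -> (forall z, 0 <= f z)%R ->
  \int[mu]_(z in D) (f z)%:E =
  \int[lebesgue_measure]_(t in @period R `&` (@expi R) @^-1` D)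
     (f (expi t) * (w t / (2 * pi)))%:E + \int[mus]_(z in D) (f z)%:E.
Proof.
move=> mD mf f0.
rewrite integral_mkcond integral_decomposition; last 2 first.
- apply/(measurable_restrictT _ _).1 => //.
  by apply: measurable_funTS; exact/measurable_EFinP.
- by move=> z; rewrite patchE; case: ifP => // _; rewrite lee_fin.
congr (_ + _); last by rewrite [RHS]integral_mkcond.
rewrite [RHS]integral_mkcondr; apply: eq_integral => t _.
by rewrite !patchE mem_angles; case: ifP => _; rewrite ?mul0e// EFinM.
Qed.

End Decomposition.

(** * The real inner product of polynomials *)

Section InnerProduct.
Variable R : realType.
Variable mu : {finite_measure set (borelC R) -> \bar R}.
Implicit Types (p q r : {poly R[i]}) (c : R[i]).

Local Notation circle := (@circle R).

(** The real part of the inner product: a real bilinear form carries all the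
    orthogonality needed, since the first argument may be multiplied by [i]. *)
Definition rinner p q : R :=
  \int[mu]_(z in circle) complex.Re ((p.[z])^* * q.[z]).

Lemma poly_bounded p : exists2 M : R, 0 <= M &
  forall z, circle z -> nsq p.[z] <= M.
Proof.
exists ((size p)%:R * \sum_(i < size p) nsq p`_i).
  by rewrite mulr_ge0// sumr_ge0// => i _; exact: nsq_ge0.
move=> z /circleP z1; rewrite horner_coef.
apply: (le_trans (nsq_sum_le _)); rewrite ler_wpM2l//.
by apply: ler_sum => i _; rewrite nsqM nsqX z1 expr1n mulr1.
Qed.

Lemma mcplx_poly p : measurable_complex (fun z : borelC R => p.[z]).
Proof. exact: (mcplx_horner p (@mcplx_id R)). Qed.

Lemma Re_conjM_le a b : `|complex.Re (a^* * b)| <= nsq a + nsq b :> R.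
Proof.
rewrite !ReIm /nsq ler_norml.
set x := complex.Re a; set y := complex.Im a; set u := complex.Re b; set v := complex.Im b.
have := sqr_ge0 (x - u); have := sqr_ge0 (x + u).
have := sqr_ge0 (y - v); have := sqr_ge0 (y + v).
have := sqr_ge0 x; have := sqr_ge0 y; have := sqr_ge0 u; have := sqr_ge0 v.
by rewrite !sqrrD !mulrN sqrrN => *; apply/andP; split; lra.
Qed.

Lemma bounded_integrable_circle (f : borelC R -> R) (M : R) :
  measurable_fun setT f -> (forall z, circle z -> `|f z| <= M) ->
  mu.-integrable circle (EFin \o f).
Proof.
move=> mf fM; apply: measurable_bounded_integrable.
- exact: measurable_circle.
- by rewrite ltey_eq fin_num_measure//; exact: measurable_circle.
- exact: measurable_funTS.
- exists M; split; first exact: num_real.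
  by move=> x Mx z cz; apply: (le_trans (fM z cz)); exact: ltW.
Qed.

Lemma integrable_rinner p q :
  mu.-integrable circle (EFin \o (fun z : borelC R => complex.Re ((p.[z])^* * q.[z]))).
Proof.
have [M M0 pM] := poly_bounded p; have [N N0 qN] := poly_bounded q.
apply: (@bounded_integrable_circle _ (M + N)).
  exact: (mcplxM (mcplxJ (mcplx_poly p)) (mcplx_poly q)).1.
move=> z cz; apply: (le_trans (Re_conjM_le _ _)).
by apply: lerD; [exact: pM|exact: qN].
Qed.

Lemma Re_inner p q : complex.Re (inner mu p q) = rinner p q.
Proof. by []. Qed.

Lemma rinnerDr p q r : rinner p (q + r) = rinner p q + rinner p r.
Proof.
rewrite /rinner -RintegralD//.
- by apply: eq_Rintegral => z _; rewrite hornerD mulrDr ReD.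
- exact: measurable_circle.
- exact: integrable_rinner.
- exact: integrable_rinner.
Qed.

Lemma rinnerC p q : rinner p q = rinner q p.
Proof. by apply: eq_Rintegral => z _; rewrite !ReIm; ring. Qed.

Lemma rinnerDl p q r : rinner (p + q) r = rinner p r + rinner q r.
Proof. by rewrite rinnerC rinnerDr !(rinnerC r). Qed.

Lemma rinner0r p : rinner p 0 = 0.
Proof. by apply: (addrI (rinner p 0)); rewrite -rinnerDr !addr0. Qed.

Lemma rinner0l p : rinner 0 p = 0.
Proof. by rewrite rinnerC rinner0r. Qed.

Lemma rinnerZ c p q : rinner (c *: p) q = rinner p (c^* *: q).
Proof. by apply: eq_Rintegral => z _; rewrite !hornerZ cjM; congr complex.Re; ring. Qed.

Lemma rinnerNr p q : rinner p (- q) = - rinner p q.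
Proof. by apply: (addrI (rinner p q)); rewrite -rinnerDr !subrr rinner0r. Qed.

Definition sqnorm p : R := \int[mu]_(z in circle) nsq p.[z].

Lemma rinner_sqnorm p : rinner p p = sqnorm p.
Proof. by apply: eq_Rintegral => z _; rewrite Re_conjM. Qed.

Lemma L2norm_sqnorm p : L2norm mu p = Num.sqrt (sqnorm p).
Proof. by congr Num.sqrt; apply: eq_Rintegral => z _; rewrite Re_norm2. Qed.

Lemma integrable_nsq p :
  mu.-integrable circle (EFin \o (fun z : borelC R => nsq p.[z])).
Proof.
apply: eq_integrable (integrable_rinner p p) => //.
  exact: measurable_circle.
by move=> z _ /=; rewrite Re_conjM.
Qed.

Lemma sqnorm_ge0 p : 0 <= sqnorm p.
Proof. by apply: Rintegral_ge0 => z _; exact: nsq_ge0. Qed.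

Lemma EFin_sqnorm p :
  ((sqnorm p)%:E = \int[mu]_(z in circle) (nsq p.[z])%:E)%E.
Proof.
rewrite /sqnorm fineK//; apply: integrable_fin_num; last exact: integrable_nsq.
exact: measurable_circle.
Qed.

Lemma sqnorm_le (a b : R) p q r : 0 <= a -> 0 <= b ->
  (forall z, circle z -> nsq p.[z] <= a * nsq q.[z] + b * nsq r.[z]) ->
  sqnorm p <= a * sqnorm q + b * sqnorm r.
Proof.
move=> a0 b0 h; have mc := @measurable_circle R.
have iZ x s : mu.-integrable circle (EFin \o (fun z : borelC R => x * nsq s.[z])).
  by apply: (integrableZl mc x (integrable_nsq s)).
rewrite /sqnorm -!RintegralZl//; try exact: integrable_nsq.
rewrite -RintegralD//.
apply: le_Rintegral => //; first exact: integrable_nsq.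
by have := integrableD mc (iZ a q) (iZ b r); apply: eq_integrable.
Qed.

Lemma sqnorm_eq_circle p q : (forall z, circle z -> nsq p.[z] = nsq q.[z]) ->
  sqnorm p = sqnorm q.
Proof. by move=> h; apply: eq_Rintegral => z; rewrite inE => cz; exact: h. Qed.

Lemma sqnormZ c p : sqnorm (c *: p) = nsq c * sqnorm p.
Proof.
rewrite /sqnorm -RintegralZl//; last 2 first.
- exact: measurable_circle.
- exact: integrable_nsq.
by apply: eq_Rintegral => z _; rewrite hornerZ nsqM.
Qed.

Lemma rinnerZZ a c p : rinner (a *: p) (c *: p) = complex.Re (a^* * c) * sqnorm p.
Proof.
rewrite /sqnorm -RintegralZl//; last 2 first.
- exact: measurable_circle.
- exact: integrable_nsq.
by apply: eq_Rintegral => z _; rewrite !hornerZ !ReIm /nsq; ring.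
Qed.

Lemma rinnerRl (x : R) p q : rinner (x%:C%C *: p) q = x * rinner p q.
Proof.
rewrite /rinner -RintegralZl//; last 2 first.
- exact: measurable_circle.
- exact: integrable_rinner.
by apply: eq_Rintegral => z _; rewrite !hornerZ !ReIm /=; ring.
Qed.

Lemma sqnorm0 : sqnorm 0 = 0.
Proof. by rewrite -rinner_sqnorm rinner0l. Qed.

Lemma sqnorm_pythagoras p q : rinner p q = 0 -> sqnorm (p + q) = sqnorm p + sqnorm q.
Proof.
move=> pq0; rewrite -!rinner_sqnorm rinnerDl !rinnerDr pq0 (rinnerC q) pq0.
by rewrite addr0 add0r.
Qed.

Lemma sqnorm_sum_le n (F : nat -> {poly R[i]}) (M : R) :
  (forall j, (j < n)%N -> sqnorm (F j) <= M) ->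
  sqnorm (\sum_(j < n) F j) <= n%:R ^+ 2 * M.
Proof.
move=> FM; have mc := @measurable_circle R.
have s m : (\sum_(j < m) sqnorm (F j) =
    \int[mu]_(z in circle) \sum_(j < m) nsq (F j).[z]) /\
    mu.-integrable circle (EFin \o (fun z : borelC R => \sum_(j < m) nsq (F j).[z])).
  elim: m => [|m [IH1 IH2]].
    split; last first.
      apply: (eq_integrable mc (EFin \o (fun z : borelC R => nsq (0 : {poly R[i]}).[z]))).
        by move=> z _ /=; rewrite big_ord0 horner0 nsq0.
      exact: integrable_nsq.
    rewrite big_ord0 -[LHS]sqnorm0; apply: eq_Rintegral => z _.
    by rewrite big_ord0 horner0 nsq0.
  split.
    rewrite big_ord_recr /= IH1 -RintegralD//; last exact: integrable_nsq.
    by apply: eq_Rintegral => z _; rewrite big_ord_recr.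
  have := integrableD mc IH2 (integrable_nsq (F m)).
  by apply: eq_integrable => // z _ /=; rewrite big_ord_recr.
apply: (@le_trans _ _ (n%:R * \sum_(j < n) sqnorm (F j))).
  rewrite (s n).1 -RintegralZl//; last exact: (s n).2.
  apply: le_Rintegral => //; first exact: integrable_nsq.
    exact: (integrableZl mc n%:R (s n).2).
  by move=> z _; rewrite horner_sum; exact: nsq_sum_le.
rewrite expr2 -mulrA ler_wpM2l//.
rewrite (_ : n%:R * M = \sum_(j < n) M); last first.
  by rewrite sumr_const card_ord mulr_natl.
by apply: ler_sum => j _; exact: FM.
Qed.

Hypothesis mu_circle : on_circle mu.
Hypothesis mu_inf : infinite_set (msupport mu).

Lemma finite_roots p : p != 0 -> finite_set [set z : R[i] | p.[z] = 0].
Proof.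
move=> p0; have [rs pE] := closed_field_poly_normal p.
apply: (@sub_finite_set _ _ [set` rs]); last exact: finite_seq.
move=> z /= /eqP; rewrite pE -rootE rootZ ?lead_coef_eq0//.
by rewrite root_prod_XsubC.
Qed.

(** A measure for which a nonzero polynomial has norm zero is supported on the
    roots of that polynomial, a finite set. *)
Lemma sqnorm_gt0 p : p != 0 -> 0 < sqnorm p.
Proof.
move=> p0; rewrite lt_def sqnorm_ge0 andbT; apply/eqP => h.
have mc := @measurable_circle R.
have oU := closed_openC (closed_finite (finite_roots p0)).
set U := ~` _ in oU.
have mU : measurable (U : set (borelC R)) by exact: open_borelC.
have muU : mu U = 0%E.
  have H : (\int[mu]_(z in circle) `|(nsq p.[z])%:E| = 0)%E.
    rewrite -[RHS]/((0 : R)%:E) -h EFin_sqnorm; apply: eq_integral => z _.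
    by rewrite /= ger0_norm// nsq_ge0.
  have : ae_eq mu circle (fun z => (nsq p.[z])%:E) (cst 0%E).
    apply/ae_eq_integral_abs => //.
    by apply/measurable_EFinP; apply: measurable_funTS; exact: measurable_nsq (mcplx_poly p).
  move=> [N [mN muN sN]].
  apply/eqP; rewrite eq_le measure_ge0 andbT.
  have sub : U `<=` N `|` ~` circle.
    move=> z Uz; have [cz|] := pselect (circle z); last by right.
    left; apply: sN => /= /(_ cz) [] /eqP; rewrite nsq_eq0 => /eqP; exact: Uz.
  have mnc : measurable (~` circle : set (borelC R)) by exact: measurableC.
  have mNc := measurableU _ _ mN mnc.
  apply: (le_trans (le_measure mu _ _ sub)); rewrite ?inE//.
  apply: (le_trans (measureU2 mu mN mnc)).
  by rewrite [X in (X + _)%E](_ : _ = 0%E)// [X in (_ + X)%E](_ : _ = 0%E)// adde0.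
apply: mu_inf; apply: sub_finite_set (finite_roots p0) => z suppz /=.
apply: contrapT => pz; have := suppz U oU pz.
by rewrite [X in (_ < X)%E](_ : _ = 0%E)// ltxx.
Qed.

End InnerProduct.

(** * Orthogonal polynomials, index shifts and regularity *)

Section Orthogonal.
Variable R : realType.
Variable mu : {finite_measure set (borelC R) -> \bar R}.
Variables (Phi : nat -> {poly R[i]}) (alpha : nat -> R[i]).
Hypothesis mu_circle : on_circle mu.
Hypothesis mu_inf : infinite_set (msupport mu).
Hypothesis OP : monic_OPs mu Phi.
Implicit Types (p q r : {poly R[i]}) (c : R[i]).

Local Notation B := (rinner mu).
Local Notation sqn := (sqnorm mu).

Definition opnorm n : R := sqnorm mu (Phi n).
Local Notation h := opnorm.

Lemma Phi_monic n : Phi n \is monic. Proof. by have [] := OP n. Qed.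

Lemma size_Phi n : size (Phi n) = n.+1. Proof. by have [] := OP n. Qed.

Lemma Phi_orth n q : (size q <= n)%N -> B q (Phi n) = 0.
Proof. by have [_ _ H] := OP n => /H; rewrite -Re_inner => ->. Qed.

Lemma opnorm_gt0 n : 0 < h n.
Proof. by apply: sqnorm_gt0 => //; exact: monic_neq0 (Phi_monic n). Qed.

Lemma size_scale_le c p n : (size p <= n)%N -> (size (c *: p) <= n)%N.
Proof. by apply: leq_trans; exact: size_scale_leq. Qed.

Lemma Phi_orthZl c n q : (size q <= n)%N -> B (c *: Phi n) q = 0.
Proof.
by move=> sq; rewrite rinnerZ rinnerC; apply: Phi_orth; exact: size_scale_le.
Qed.

Lemma Phi_orthZr c n q : (size q <= n)%N -> B q (c *: Phi n) = 0.
Proof. by move=> sq; rewrite rinnerC Phi_orthZl. Qed.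

Lemma size_sub_monic p q n : p \is monic -> q \is monic ->
  size p = n.+1 -> size q = n.+1 -> (size (p - q)%R <= n)%N.
Proof.
move=> /monicP pm /monicP qm sp sq; apply/leq_sizeP => j.
rewrite leq_eqVlt coefB => /orP[/eqP <-|nj].
  by move: pm qm; rewrite !lead_coefE sp sq /= => -> ->; rewrite subrr.
by rewrite !nth_default ?subrr// ?sp ?sq.
Qed.

Lemma sqnormXn k p : sqn ('X^k * p) = sqn p.
Proof.
apply: sqnorm_eq_circle => z /circleP z1.
by rewrite hornerM hornerXn nsqM nsqX z1 expr1n mul1r.
Qed.

(** The failure of multiplication by [z ^+ k] to be the index shift on the
    orthogonal polynomials. *)
Definition shift_error k m : {poly R[i]} := 'X^k * Phi m - Phi (k + m).

Lemma size_shift_error k m : (size (shift_error k m) <= k + m)%N.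
Proof.
apply: size_sub_monic; rewrite ?size_Phi ?Phi_monic//.
  by rewrite rpredM ?monicXn ?Phi_monic.
by rewrite size_monicM ?monicXn ?(monic_neq0 (Phi_monic m))// size_polyXn size_Phi addnS.
Qed.

(** The error is orthogonal to [Phi (k + m)], so this is Pythagoras. *)
Lemma sqnorm_shift_error k m : sqn (shift_error k m) = h m - h (k + m).
Proof.
have := sqnorm_pythagoras (Phi_orth (size_shift_error k m)).
by rewrite subrK sqnormXn -/(h m) => ->; rewrite -/(h (k + m)) addrK.
Qed.

Lemma opnorm_shift_le k m : h (k + m) <= h m.
Proof. by rewrite -subr_ge0 -sqnorm_shift_error sqnorm_ge0. Qed.

Lemma opnorm_le m n : (m <= n)%N -> h n <= h m.
Proof. by move=> mn; rewrite -(subnK mn) opnorm_shift_le. Qed.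

Hypothesis verb : verblunsky Phi alpha.

(** On the circle the reversed polynomial has the modulus of the original one,
    so the recurrence gives the norm of the one-step shift error. *)
Lemma opnormS n : h n.+1 = (1 - nsq (alpha n)) * h n.
Proof.
have e : sqn (shift_error 1 n) = nsq (alpha n) * h n.
  rewrite -sqnormZ; apply: sqnorm_eq_circle => z /circleP z1.
  have z0 : z != 0 by rewrite -nsq_gt0 z1.
  rewrite hornerZ /shift_error hornerD hornerN hornerM hornerXn expr1 add1n.
  rewrite (verb n z0) opprB addrC subrK nsqM nsqJ /reversed nsqM nsqX z1 expr1n mul1r nsqJ.
  rewrite nsqM; congr (_ * nsq _.[_]).
  have zJ : z^* * z = 1 by rewrite mulrC mulCJ z1.
  by rewrite -[LHS]mulr1 -zJ mulKf// -[_ == 0]nsq_eq0 nsqJ z1 oner_eq0.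
by have := sqnorm_shift_error 1 n; rewrite e add1n; lra.
Qed.

Lemma rho_gt0 n : 0 < rho alpha n /\ rho alpha n ^+ 2 = h n.+1 / h n.
Proof.
have := opnormS n; have := opnorm_gt0 n; have := opnorm_gt0 n.+1 => h1 h0 e.
have e' : 1 - nsq (alpha n) = h n.+1 / h n by rewrite e mulfK// gt_eqF.
have pos : 0 < 1 - nsq (alpha n) by rewrite e' divr_gt0.
by rewrite /rho Re_norm2 sqrtr_gt0 sqr_sqrtr ?(ltW pos).
Qed.

Lemma prod_rho n : 0 < \prod_(1 <= j < n.+1) rho alpha j /\
  (\prod_(1 <= j < n.+1) rho alpha j) ^+ 2 = h n.+1 / h 1.
Proof.
elim: n => [|n [IH1 IH2]].
  by rewrite big_nil expr1n divff// gt_eqF// opnorm_gt0.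
rewrite big_nat_recr//= exprMn IH2; have [r0 ->] := rho_gt0 n.+1.
rewrite mulr_gt0//; split => //.
by rewrite mulrC mulrA divfK// gt_eqF// opnorm_gt0.
Qed.

Hypothesis reg : regular_circle alpha.

(** The product of the [rho alpha j] is a ratio of norms, so regularity says that
    the norms decay subexponentially. *)
Lemma regular_ln : (ln (h 1) - ln (h n.+1)) / n%:R @[n --> \oo] --> (0 : R).
Proof.
have H1 : ln ((\prod_(1 <= j < n.+1) rho alpha j) `^ (n%:R^-1)) @[n --> \oo] --> (0 : R).
  rewrite -[X in _ --> X]ln1; apply: continuous_cvg => //; exact: continuous_ln.
rewrite -[X in _ --> X](mulr0 (- 2)).
rewrite (_ : (fun n => _) = (fun n =>
  - 2 * ln ((\prod_(1 <= j < n.+1) rho alpha j) `^ (n%:R^-1)))); first exact: cvgMr.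
apply/funext => n; have [p0 p2] := prod_rho n.
rewrite ln_powR mulrCA [in RHS]mulrC; congr (_ / _).
have -> (x : R) : - 2 * ln x = - (ln x *+ 2) by rewrite mulNr mulr_natl.
by rewrite -lnXn// p2 ln_div ?posrE ?opnorm_gt0// opprB.
Qed.

Lemma telescope_shift_le (g : nat -> R) k n :
  (forall i j, (i <= j)%N -> g j <= g i) ->
  \sum_(m < n) (g m - g (k + m)%N) <= k%:R * (g 0%N - g (k + n)%N).
Proof.
move=> gd; elim: k => [|k IH].
  by rewrite mul0r big1// => m _; rewrite add0n subrr.
rewrite (eq_bigr (fun m : 'I_n => (g m - g (k + m)%N) + (g (k + m)%N - g (k + m).+1))); last first.
  by move=> m _; rewrite addSn; ring.
rewrite big_split/= -natr1 mulrDl mul1r lerD//.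
  by apply: (le_trans IH); rewrite ler_wpM2l// lerB// gd// addSn leqnSn.
have -> : \sum_(m < n) (g (k + m)%N - g (k + m).+1) = g k - g (k + n)%N.
  elim: n {IH} => [|n IH]; first by rewrite big_ord0 addn0 subrr.
  by rewrite big_ord_recr /= IH addnS; ring.
by rewrite lerB// gd// addSn leqnSn.
Qed.

(** The relative losses are dominated by differences of logarithms, which
    telescope. *)
Lemma average_shift_loss k (e : R) : 0 < e ->
  \forall n \near \oo, \sum_(m < n.+1) (1 - h (k + m) / h m) <= e * n.+1%:R.
Proof.
move=> e0; pose d := e / (2 * k.+1%:R).
have d0 : 0 < d by rewrite divr_gt0// mulr_gt0.
have /cvgrPdist_lt/(_ d d0) [M _ HM] := regular_ln.
pose C := ln (h 0) - ln (h 1).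
near=> n.
have lnd i j : (i <= j)%N -> ln (h j) <= ln (h i).
  by move=> ij; rewrite ler_ln ?posrE ?opnorm_gt0// opnorm_le.
apply: (@le_trans _ _ (\sum_(m < n.+1) (ln (h m) - ln (h (k + m))))).
  apply: ler_sum => m _.
  have q0 : 0 < h (k + m) / h m by rewrite divr_gt0 ?opnorm_gt0.
  have := le_ln1Dx (x := h (k + m) / h m - 1).
  rewrite ltrBDr addNr q0 => /(_ isT).
  by rewrite addrC subrK ln_div ?posrE ?opnorm_gt0//; lra.
apply: (le_trans (telescope_shift_le _ _ lnd)).
have Mn : (M <= k + n)%N by apply: (leq_trans _ (leq_addl _ _)); near: n; exact: nbhs_infty_ge.
have n0 : (0 < n)%N by near: n; exact: nbhs_infty_gt.
have := HM (k + n)%N Mn; rewrite /= sub0r normrN => /ltr_normlW.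
rewrite ltr_pdivrMr; last by rewrite ltr0n addn_gt0 n0 orbT.
rewrite addnS natrD => H.
have Cn : C + d * k%:R <= d * n%:R.
  rewrite [leRHS]mulrC -ler_pdivrMr//; near: n; exact: nbhs_infty_ger.
rewrite -natr1.
have : ln (h 0) - ln (h (k + n).+1) <= 2 * d * n%:R.
  rewrite mulrDr in H; rewrite /C in Cn; lra.
move=> H'; apply: (@le_trans _ _ (k%:R * (2 * d * n%:R))); first by rewrite ler_wpM2l.
have -> : k%:R * (2 * d * n%:R) = e * (k%:R / k.+1%:R) * n%:R.
  by rewrite /d; field; rewrite nat1r pnatr_eq0.
rewrite -mulrA ler_wpM2l ?(ltW e0)//.
apply: (@le_trans _ _ n%:R); last by rewrite lerDl.
by rewrite ler_piMl// ler_pdivrMr// mul1r ler_nat.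
Unshelve. all: by end_near. Qed.

Lemma sqnorm_orth_sum (c : nat -> R[i]) m n : (forall j, nsq (c j) = 1) ->
  sqn (\sum_(j < n) c j *: Phi (j + m)) = \sum_(j < n) h (j + m).
Proof.
move=> c1; elim: n => [|n IH]; first by rewrite !big_ord0 sqnorm0.
rewrite !big_ord_recr /= sqnorm_pythagoras ?IH ?sqnormZ ?c1 ?mul1r//.
apply: Phi_orthZr.
apply: (leq_trans (size_sum _ _ _)); apply/bigmax_leqP => j _.
by apply: size_scale_le; rewrite size_Phi ltn_add2r.
Qed.

(** Multiplication by [z] acts on the orthogonal polynomials almost as the index
    shift, so a trigonometric polynomial with unimodular coefficients has almost
    the norm it would have if the shifted polynomials replaced the products. *)
Lemma sqnorm_shift_sum (c : nat -> R[i]) (eta : R) m n :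
  (forall j, nsq (c j) = 1) -> 0 < eta ->
  sqn (\sum_(j < n.+1) c j *: ('X^j * Phi m)) <=
    (1 + eta) * (n.+1%:R * h m) + (1 + eta^-1) * (n.+1%:R ^+ 2 * (h m - h (n + m))).
Proof.
move=> c1 eta0.
pose U := \sum_(j < n.+1) c j *: Phi (j + m).
pose V := \sum_(j < n.+1) c j *: shift_error j m.
have -> : \sum_(j < n.+1) c j *: ('X^j * Phi m) = U + V.
  rewrite -big_split /=; apply: eq_bigr => j _.
  by rewrite -scalerDr addrC subrK.
have a0 : 0 <= 1 + eta by rewrite addr_ge0// ltW.
have b0 : 0 <= 1 + eta^-1 by rewrite addr_ge0// invr_ge0 ltW.
apply: (@le_trans _ _ ((1 + eta) * sqn U + (1 + eta^-1) * sqn V)).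
  by apply: sqnorm_le => // z _; rewrite hornerD; exact: nsqD_le.
apply: lerD; rewrite ler_wpM2l//.
  rewrite sqnorm_orth_sum//.
  have -> : n.+1%:R * h m = \sum_(j < n.+1) h m by rewrite sumr_const card_ord mulr_natl.
  by apply: ler_sum => j _; exact: opnorm_shift_le.
apply: (sqnorm_sum_le (F := fun j => c j *: shift_error j m)) => j jn.
rewrite sqnormZ c1 mul1r sqnorm_shift_error.
by rewrite lerB// opnorm_le// leq_add2r.
Qed.

Lemma CD_diagE n z : CD_diag mu Phi n z = \sum_(j < n.+1) nsq (Phi j).[z] / h j.
Proof.
rewrite /CD_diag /CD_kernel Re_sum; apply: eq_bigr => j _.
rewrite Re_conjM /normalized hornerZ nsqM L2norm_sqnorm -/(h j) mulrC.
by congr (_ * _); rewrite -fmorphV /= nsqR exprVn sqr_sqrtr// sqnorm_ge0.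
Qed.

Lemma CD_diag_ge0 n z : 0 <= CD_diag mu Phi n z.
Proof.
rewrite CD_diagE sumr_ge0// => j _; apply: divr_ge0; first exact: nsq_ge0.
by rewrite ltW// opnorm_gt0.
Qed.

Lemma measurable_CD_diag n : measurable_fun setT (CD_diag mu Phi n : borelC R -> R).
Proof.
rewrite (_ : CD_diag mu Phi n = fun z => \sum_(j < n.+1) nsq (Phi j).[z] / h j); last first.
  by apply/funext => z; exact: CD_diagE.
apply: measurable_sum => j; apply: measurable_funM => //.
exact: measurable_nsq (mcplx_poly _).
Qed.

(** The kernel as a polynomial in its second variable. *)
Definition CD_section n z : {poly R[i]} :=
  \sum_(j < n) ((Phi j).[z]^* * ((h j)^-1)%:C%C) *: Phi j.

Lemma size_CD_section n z : (size (CD_section n z) <= n)%N.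
Proof.
apply: (leq_trans (size_sum _ _ _)); apply/bigmax_leqP => j _.
by apply: size_scale_le; rewrite size_Phi.
Qed.

(** Induction on the degree: subtracting the right multiple of [Phi n] lowers the
    degree of [p], and the last term of the kernel only sees that multiple. *)
Lemma CD_section_reproducing n z p :
  (size p <= n)%N -> B (CD_section n z) p = complex.Re p.[z].
Proof.
elim: n p => [|n IH] p sp.
  have -> : p = 0 by apply/eqP; rewrite -size_poly_eq0 -leqn0.
  by rewrite rinner0r horner0.
pose q := p - p`_n *: Phi n.
have sq : (size q <= n)%N.
  apply/leq_sizeP => j; rewrite leq_eqVlt coefB coefZ => /orP[/eqP <-|nj].
    have /monicP := Phi_monic n; rewrite lead_coefE size_Phi /= => ->.
    by rewrite mulr1 subrr.
  rewrite [p`_j]nth_default ?(leq_trans sp)// [(Phi n)`_j]nth_default ?size_Phi//.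
  by rewrite mulr0 subrr.
have -> : p = q + p`_n *: Phi n by rewrite subrK.
rewrite rinnerDr hornerD ReD /CD_section big_ord_recr /= -/(CD_section n z).
rewrite !rinnerDl IH// (Phi_orthZl _ sq) addr0 (Phi_orthZr _ (size_CD_section n z)) add0r.
congr (_ + _); rewrite hornerZ.
set c := p`_n; set a := (Phi n).[z].
have hn := opnorm_gt0 n.
rewrite rinnerZZ -/(h n) !ReIm /=; field; rewrite gt_eqF//.
Qed.

(** Christoffel's variational bound: the Cauchy-Schwarz inequality between [p] and
    the reproducing polynomial, in the form of the nonnegativity of one square. *)
Lemma christoffel n z p : (size p <= n.+1)%N -> p.[z] = 1 ->
  1 <= CD_diag mu Phi n z * sqn p.
Proof.
move=> sp pz; pose k := CD_section n.+1 z.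
have kp : B k p = 1 by rewrite CD_section_reproducing// pz.
have kk : B k k = CD_diag mu Phi n z.
  rewrite CD_section_reproducing ?size_CD_section// CD_diagE /k /CD_section.
  rewrite horner_sum Re_sum; apply: eq_bigr => j _.
  by rewrite hornerZ !ReIm /= /nsq; ring.
have p0 : p != 0 by apply/eqP => p0; move/eqP: pz; rewrite p0 horner0 eq_sym oner_eq0.
have pp := sqnorm_gt0 mu_circle mu_inf p0.
set x := (sqn p)^-1.
have e1 : B (x%:C%C *: p) (x%:C%C *: p) = x.
  by rewrite rinnerRl rinnerC rinnerRl rinner_sqnorm /x mulVf ?mulr1// gt_eqF.
have e2 : B (x%:C%C *: p) (- k) = - x by rewrite rinnerNr rinnerRl rinnerC kp mulr1.
have : 0 <= sqn (x%:C%C *: p - k) by exact: sqnorm_ge0.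
rewrite -rinner_sqnorm rinnerDl !rinnerDr e1 (rinnerC _ (- k)) e2.
rewrite rinnerNr (rinnerC _ (- k)) rinnerNr opprK kk subrr add0r addrC subr_ge0.
by rewrite /x -ler_pdivrMr// mul1r.
Qed.

End Orthogonal.

(** * The Christoffel-Darboux measures and the Fejer kernel *)

Section UpperBound.
Variable R : realType.
Variable mu : {finite_measure set (borelC R) -> \bar R}.
Variables (Phi : nat -> {poly R[i]}) (alpha : nat -> R[i]).
Hypothesis mu_circle : on_circle mu.
Hypothesis mu_inf : infinite_set (msupport mu).
Hypothesis OP : monic_OPs mu Phi.
Hypothesis verb : verblunsky Phi alpha.
Hypothesis reg : regular_circle alpha.
Implicit Types (z u : R[i]) (t : R).

Local Notation circle := (@circle R).
Local Notation leb := (@lebesgue_measure R).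
Local Notation h := (opnorm mu Phi).

Definition cd_mean n z : R := n.+1%:R^-1 * CD_diag mu Phi n z.
Local Notation kap := cd_mean.

Lemma cd_mean_ge0 n z : 0 <= kap n z.
Proof. by rewrite mulr_ge0 ?invr_ge0// CD_diag_ge0. Qed.

Lemma measurable_cd_mean n : measurable_fun setT (kap n : borelC R -> R).
Proof. by apply: measurable_funM => //; exact: measurable_CD_diag. Qed.

(** A weight [F] which, multiplied with the squared modulus of [Phi m], gives that
    of another polynomial: this covers the total mass and the Fejer kernel. *)
Lemma integral_cd_mean_weight n (a : nat -> R) (F : R[i] -> R) (p : nat -> {poly R[i]}) :
  (forall m, 0 <= a m) ->
  (forall m z, circle z -> F z * nsq (Phi m).[z] = a m * nsq (p m).[z]) ->
  (\int[mu]_(z in circle) (F z * kap n z)%:E =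
   (n.+1%:R^-1 * \sum_(m < n.+1) a m * sqnorm mu (p m) / h m)%:E)%E.
Proof.
move=> a0 Fp; have mc := @measurable_circle R.
transitivity (\int[mu]_(z in circle) \sum_(m < n.+1)
    (n.+1%:R^-1 * a m / h m)%:E * (nsq (p m).[z])%:E)%E.
  apply: eq_integral => z; rewrite inE => cz.
  under eq_bigr do rewrite -EFinM.
  rewrite sumEFin /cd_mean CD_diagE//; congr EFin.
  rewrite mulrCA mulr_sumr mulr_sumr; apply: eq_bigr => m _.
  rewrite [LHS](_ : _ = n.+1%:R^-1 * (F z * nsq (Phi m).[z]) / h m); last by ring.
  by rewrite Fp//; ring.
have mp (m : nat) : measurable_fun (circle : set (borelC R))
    (fun z : borelC R => (nsq (p m).[z])%:E).
  by apply/measurable_EFinP; apply: measurable_funTS; exact: measurable_nsq (mcplx_poly _).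
have w0 (m : nat) : 0 <= n.+1%:R^-1 * a m / h m.
  by rewrite !mulr_ge0 ?invr_ge0// ltW// opnorm_gt0.
rewrite ge0_integral_sum//; last 2 first.
- by move=> m; exact: measurable_funeM.
- by move=> m z _; rewrite mule_ge0// lee_fin ?nsq_ge0//; exact: w0.
rewrite mulr_sumr -sumEFin; apply: eq_bigr => m _.
rewrite ge0_integralZl_EFin//; last by move=> z _; rewrite lee_fin nsq_ge0.
by rewrite -EFin_sqnorm -EFinM; congr EFin; ring.
Qed.

Lemma integral_cd_mean n : (\int[mu]_(z in circle) (kap n z)%:E = 1)%E.
Proof.
transitivity (\int[mu]_(z in circle) (1 * kap n z)%:E)%E.
  by apply: eq_integral => z _; rewrite mul1r.
rewrite (@integral_cd_mean_weight n (fun=> 1) _ Phi)//.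
congr EFin; rewrite (eq_bigr (fun=> 1)) => [|m _]; last first.
  by rewrite mul1r divff// gt_eqF// opnorm_gt0.
by rewrite sumr_const card_ord mulVf// pnatr_eq0.
Qed.

(** Multiplying [Phi m] by the sum inside the Fejer kernel produces a unimodular
    combination of shifts, and the excess of its norm is a shift loss. The loss is
    small on average over [m], and does not depend on the centre [u]. *)
Lemma integral_fejer_cd_mean N (e : R) : 0 < e ->
  \forall n \near \oo, forall u, circle u ->
    (\int[mu]_(z in circle) (fejer N z u * kap n z)%:E <= (1 + e)%:E)%E.
Proof.
move=> e0; pose eta := e / 2.
have eta0 : 0 < eta by rewrite divr_gt0.
pose b := (1 + eta^-1) * N.+1%:R.
have b0 : 0 < b by rewrite mulr_gt0// addr_gt0// invr_gt0.
have /(_ _ (divr_gt0 eta0 b0)) := average_shift_loss mu_circle mu_inf OP verb reg N.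
apply: filterS => n Hn u /circleP u1.
(* [fejer N z u * nsq (Phi m).[z]] is [nsq (p m).[z] / N.+1] *)
pose p m := \sum_(j < N.+1) (u^* ^+ j) *: ('X^j * Phi m).
rewrite (@integral_cd_mean_weight n (fun=> N.+1%:R^-1) _ p); last 2 first.
- by move=> m; rewrite invr_ge0.
- move=> m z _; rewrite /fejer mulrAC mulrC -nsqM; congr (_ * nsq _).
  rewrite mulr_suml horner_sum; apply: eq_bigr => j _.
  by rewrite hornerZ hornerM hornerXn exprMn; ring.
rewrite lee_fin.
apply: (@le_trans _ _ (n.+1%:R^-1 *
    \sum_(m < n.+1) (1 + eta + b * (1 - h (N + m) / h m)))).
  rewrite ler_wpM2l ?invr_ge0//; apply: ler_sum => m _.
  have hm := opnorm_gt0 mu_circle mu_inf OP m.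
  rewrite ler_pdivrMr// mulrC ler_pdivrMr//.
  have c1 j : nsq (u^* ^+ j) = 1 by rewrite nsqX nsqJ u1 expr1n.
  apply: (le_trans (sqnorm_shift_sum OP m N c1 eta0)).
  rewrite le_eqVlt; apply/orP; left; apply/eqP.
  by rewrite /b; field; rewrite gt_eqF//= gt_eqF.
rewrite big_split /= sumr_const card_ord -mulr_sumr mulrDr.
rewrite -[(1 + eta) *+ _]mulr_natr mulrCA mulVf ?pnatr_eq0// mulr1.
have : n.+1%:R^-1 * (b * (\sum_(m < n.+1) (1 - h (N + m) / h m))) <= eta.
  rewrite mulrC ler_pdivrMr// mulrC -ler_pdivlMr//.
  by apply: (le_trans Hn); rewrite mulrAC.
move=> H; apply: (@le_trans _ _ (1 + eta + eta)); first by rewrite lerD2l.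
by rewrite /eta; lra.
Qed.

End UpperBound.

Section ArcNeighbourhoods.
Variable R : realType.
Implicit Types (z u : R[i]) (t : R).
Local Notation leb := (@lebesgue_measure R).
Local Notation period := (@period R).

Lemma measurable_period : measurable period.
Proof. exact: measurable_itv. Qed.

Lemma lebesgue_period : leb period = (2 * pi)%:E.
Proof.
rewrite lebesgue_measure_itv /= lte_fin mulr_gt0// ?pi_gt0//.
by rewrite -EFinB subr0.
Qed.

Lemma lebesgue_sub_period (A : set R) : measurable A -> A `<=` period ->
  leb A \is a fin_num.
Proof.
move=> mA sA; rewrite ge0_fin_numE//; apply: (@le_lt_trans _ _ (leb period)).
  by apply: le_measure; rewrite ?inE//; exact: measurable_period.
by rewrite lebesgue_period ltry.
Qed.

Lemma measurable_angles (A : set (borelC R)) : measurable A ->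
  measurable (period `&` (@expi R) @^-1` A).
Proof.
move=> mA; apply: measurableI; first exact: measurable_period.
by rewrite -[X in measurable X]setTI; exact: measurable_expi.
Qed.

Definition thickening (C : set R[i]) (d : R) : set R[i] :=
  [set z | exists2 c, C c & nsq (z - c) < d].

Lemma open_thickening C d : @open R[i]^o (thickening C d).
Proof.
apply/open_complexP => z [c Cc zc].
set a := nsq (z - c) in zc.
have a0 : 0 <= a := nsq_ge0 _.
pose eta := (d - a) / (2 * (a + 1)).
have a1 : 0 < a + 1 by rewrite ltr_wpDl.
have eta0 : 0 < eta by rewrite divr_gt0 ?subr_gt0// mulr_gt0.
have eta1 : 0 < 1 + eta^-1 by rewrite addr_gt0// invr_gt0.
exists ((d - a) / (2 * (1 + eta^-1))); first by rewrite divr_gt0 ?subr_gt0// mulr_gt0.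
move=> v zv; exists c => //.
rewrite -nsqN opprB in zv.
have -> : v - c = (z - c) + (v - z) by ring.
apply: (le_lt_trans (nsqD_le _ _ eta0)); rewrite -/a.
have H : (1 + eta^-1) * nsq (v - z) < (d - a) / 2.
  by move: zv; rewrite invfM mulrA ltr_pdivlMr// mulrC.
have : eta * a <= (d - a) / 2.
  rewrite /eta invfM mulrA -mulrA ler_piMr ?divr_ge0 ?subr_ge0 ?(ltW zc)//.
  by rewrite mulrC ler_pdivrMr// mul1r lerDl.
by move=> H2; rewrite [(1 + eta) * a]mulrDl mul1r; lra.
Qed.

(** Continuity of Lebesgue measure along the shrinking neighbourhoods of the
    closed hull of the arc. *)
Lemma arc_neighbourhood (J : interval R) (e : R) : 0 < e ->
  exists (S : set R) (d : R), [/\ measurable S, S `<=` period, 0 < d,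
    (leb S <= leb (period `&` (@expi R) @^-1` circle_arc J) + e%:E)%E &
    forall z t, circle_arc J z -> period t -> ~ S t -> d <= nsq (z - expi t)].
Proof.
move=> e0; have [C [cC sC fC]] := arc_hull J.
pose S m := period `&` (@expi R) @^-1` (thickening C m.+1%:R^-1).
have mS m : measurable (S m).
  by apply: measurable_angles; apply: open_borelC; exact: open_thickening.
have capS : \bigcap_m S m = period `&` (@expi R) @^-1` C.
  apply/seteqP; split => t.
    move=> St; have [pt _] := St 0%N I; split => //; apply: contrapT => nC.
    have [d d0 dC] := closed_sep cC nC.
    have [k] := ltr_add_invr d0; rewrite add0r => kd.
    have [_ [c Cc]] := St k I.
    by move=> /lt_trans /(_ kd); rewrite ltNge dC.
  by move=> [pt Ct] m _; split => //; exists (expi t) => //; rewrite subrr nsq0 invr_gt0.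
have mC := measurable_angles (closed_borelC cC).
have H : (leb \o S) m @[m --> \oo] --> leb (\bigcap_m S m).
  apply: nonincreasing_cvg_mu => //.
  - by rewrite -ge0_fin_numE//; apply: lebesgue_sub_period => //; exact: subIsetl.
  - by rewrite capS.
  - move=> m n mn; apply/subsetPset => t [pt [c Cc ct]]; split => //; exists c => //.
    by apply: (lt_le_trans ct); rewrite lef_pV2 ?posrE// ler_nat ltnS.
have mJ := measurable_angles (measurable_arc J).
have Cle : (leb (period `&` (@expi R) @^-1` C) <=
    leb (period `&` (@expi R) @^-1` circle_arc J))%E.
  have mD := measurable_angles (measurableD (closed_borelC cC) (measurable_arc J)).
  apply: (@le_trans _ _ (leb ((period `&` (@expi R) @^-1` circle_arc J) `|`
     (period `&` (@expi R) @^-1` (C `\` circle_arc J))))).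
    apply: le_measure; rewrite ?inE//; first exact: measurableU.
    move=> t [pt Ct]; have [Jt|nJt] := pselect (circle_arc J (expi t)); first by left.
    by right.
  have := measureU2 (@lebesgue_measure R) mJ mD => /le_trans; apply.
  rewrite [X in (_ + X)%E](_ : _ = 0%E) ?adde0//.
  exact: lebesgue_finite_angles fC.
have finC : leb (\bigcap_m S m) \is a fin_num.
  by rewrite capS; apply: lebesgue_sub_period => //; exact: subIsetl.
have [m Hm] : exists m, (leb (S m) <= leb (\bigcap_m S m) + e%:E)%E.
  move: H; rewrite -(fineK finC) => /fine_cvgP[_ /cvgrPdist_le/(_ e e0)[m _ Hm]].
  exists m; have := Hm m (leqnn m); rewrite /= => /ler_distlCDr.
  by rewrite -EFinD -lee_fin fineK//; apply: lebesgue_sub_period => //; exact: subIsetl.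
exists (S m), m.+1%:R^-1; split => //.
- exact: subIsetl.
- by apply: (le_trans Hm); rewrite leeD2r// capS.
- move=> z t Jz pt nSt; rewrite leNgt; apply/negP => zt; apply: nSt; split => //.
  by exists z; [exact: sC|rewrite -nsqN opprB].
Qed.

End ArcNeighbourhoods.

(** * Upper bound for the mass of an arc *)

Section FejerAway.
Variable R : realType.
Implicit Types (z u : R[i]) (t : R) (S : set R).
Local Notation leb := (@lebesgue_measure R).
Local Notation period := (@period R).

Lemma measurable_fejer_angle n z :
  measurable_fun setT (fun t : R => fejer n z (expi t)).
Proof. by apply: measurable_fejer; [exact: mcplx_cst|exact: mcplx_expi]. Qed.

Lemma measurable_fejer_point n u :
  measurable_fun setT (fun z : borelC R => fejer n z u).
Proof. by apply: measurable_fejer; [exact: mcplx_id|exact: mcplx_cst]. Qed.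

Lemma integral_fejer_sub n z S : circle z -> measurable S -> S `<=` period ->
  (\int[leb]_(t in S) (fejer n z (expi t))%:E <= (2 * pi)%:E)%E.
Proof.
move=> cz mS sS; rewrite -(integral_fejer n cz).
apply: ge0_subset_integral => //.
- exact: measurable_period.
- by apply/measurable_EFinP; apply: measurable_funTS; exact: measurable_fejer_angle.
- by move=> t _; rewrite lee_fin fejer_ge0.
Qed.

(** Concentration. It serves twice: for the points of an arc and the angles away
    from it, and for the points carrying the singular part. *)
Lemma integral_fejer_away n z S (d : R) : circle z -> measurable S -> S `<=` period ->
  0 < d -> (forall t, S t -> d <= nsq (z - expi t)) ->
  (\int[leb]_(t in S) (fejer n z (expi t))%:E <= (8 * pi / d / n.+1%:R)%:E)%E.
Proof.
move=> cz mS sS d0 Sd.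
apply: (@le_trans _ _ (\int[leb]_(t in S) (4 / (n.+1%:R * d))%:E)%E).
  apply: ge0_le_integral => //.
  - by move=> t _; rewrite lee_fin fejer_ge0.
  - by apply/measurable_EFinP; apply: measurable_funTS; exact: measurable_fejer_angle.
  - move=> t St; rewrite lee_fin; apply: fejer_le => //.
    + by apply/circleP.
    + exact: nsq_expi.
    + exact: Sd.
rewrite integral_cst//.
have c0 : 0 <= 4 / (n.+1%:R * d) by rewrite divr_ge0// mulr_ge0// ltW.
apply: (@le_trans _ _ ((4 / (n.+1%:R * d))%:E * leb period)%E).
  apply: lee_wpmul2l; first by rewrite lee_fin.
  by apply: le_measure; rewrite ?inE//; exact: measurable_period.
rewrite lebesgue_period -EFinM lee_fin le_eqVlt; apply/orP; left; apply/eqP.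
by field; rewrite nat1r pnatr_eq0/= gt_eqF.
Qed.

Lemma nbhs_infty_div_le (c e : R) : 0 < e -> \forall n \near \oo, c / n.+1%:R <= e.
Proof.
move=> e0; near=> n.
rewrite ler_pdivrMr// mulrC -ler_pdivrMr//.
apply: (@le_trans _ _ n%:R); last by rewrite ler_nat.
by near: n; exact: nbhs_infty_ger.
Unshelve. all: by end_near. Qed.

Lemma measurable_fejer2 n : measurable_fun setT
  (fun x : borelC R * R => fejer n x.1 (expi x.2)).
Proof.
apply: measurable_fejer.
  exact: (mcplx_comp (@measurable_fst _ _ (borelC R) (measurableTypeR R)) (@mcplx_id R)).
exact: (mcplx_comp (@measurable_snd _ _ (borelC R) (measurableTypeR R)) (@mcplx_expi R)).
Qed.

End FejerAway.

Section ArcUpperBound.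
Variable R : realType.
Variable mu : {finite_measure set (borelC R) -> \bar R}.
Variables (Phi : nat -> {poly R[i]}) (alpha : nat -> R[i]).
Hypothesis mu_circle : on_circle mu.
Hypothesis mu_inf : infinite_set (msupport mu).
Hypothesis OP : monic_OPs mu Phi.
Hypothesis verb : verblunsky Phi alpha.
Hypothesis reg : regular_circle alpha.
Implicit Types (z u : R[i]) (t : R).

Local Notation circle := (@circle R).
Local Notation leb := (@lebesgue_measure R).
Local Notation kap := (cd_mean mu Phi).
Local Notation period := (@period R).

Let mkap n (D : set (borelC R)) : measurable_fun D (fun z => (kap n z)%:E).
Proof.
by apply/measurable_EFinP; apply: measurable_funTS; exact: measurable_cd_mean.
Qed.

Let kap0 n z : 0 <= kap n z. Proof. exact: cd_mean_ge0. Qed.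

Lemma arc_sub_circle J : circle_arc J `<=` circle.
Proof. by move=> _ [t _ <-]; exact: circle_expi. Qed.

(** The Fejer means of the indicator of a neighbourhood of the arc are almost 1 on
    the arc, while by Tonelli their integral against the Christoffel-Darboux
    measure is at most about the length of the neighbourhood. This is the needed
    half of the weak convergence of these measures to the uniform one. *)
Lemma integral_cd_mean_arc (J : interval R) (e : R) : 0 < e ->
  \forall n \near \oo,
    ((2 * pi)%:E * \int[mu]_(z in circle_arc J) (kap n z)%:E <=
     leb (period `&` (@expi R) @^-1` circle_arc J) + e%:E)%E.
Proof.
move=> e0; have e3 : 0 < e / 3 by rewrite divr_gt0.
have pi0 : 0 < 2 * pi :> R by rewrite mulr_gt0// pi_gt0.
(* [e / 3] for the widening of the arc, for the mass of the kernel away from it,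
   and for the excess [e2] over the uniform measure *)
have [S [d [mS sS d0 leS Sd]]] := arc_neighbourhood J e3.
have [N _ /(_ N (leqnn N)) HN] := nbhs_infty_div_le (8 * pi / d) e3.
pose b := 2 * pi + e / 3.
have b0 : 0 < b by rewrite addr_gt0.
pose e2 := e / 3 / b.
have e20 : 0 < e2 by rewrite divr_gt0.
have := integral_fejer_cd_mean mu_circle mu_inf OP verb reg N e20.
apply: filterS => n Hn.
have mI := measurable_arc J; have mc := @measurable_circle R.
set I := circle_arc J in mI leS Sd *.
have mP := @measurable_period R.
have mF z : measurable_fun setT (fun t : R => (fejer N z (expi t))%:E).
  by apply/measurable_EFinP; exact: measurable_fejer_angle.
have mSc : measurable (period `\` S) by exact: measurableD.
have split z : I z -> ((2 * pi)%:E <=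
    \int[leb]_(t in S) (fejer N z (expi t))%:E + (e / 3)%:E)%E.
  move=> Iz; have cz := arc_sub_circle Iz.
  rewrite -(integral_fejer N cz) -{1}(setDUK sS) ge0_integral_setU//; last 3 first.
  - exact: (measurable_funTS (mF z)).
  - by move=> t _; rewrite lee_fin fejer_ge0.
  - by apply/disj_setPS => t [St []].
  apply: leeD2l; apply: (le_trans (integral_fejer_away N cz mSc _ d0 _)).
  - exact: subDsetl.
  - by move=> t [pt nSt]; exact: Sd.
  - by rewrite lee_fin.
pose G z := (\int[leb]_(t in S) (fejer N z (expi t) * kap n z)%:E)%E.
have mFk : measurable_fun setT (fun x : borelC R * R => fejer N x.1 (expi x.2) * kap n x.1).
  apply: measurable_funM; first exact: measurable_fejer2.
  have mk : measurable_fun setT (kap n : borelC R -> R) by exact: measurable_cd_mean.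
  exact: (measurableT_comp mk (@measurable_fst _ _ (borelC R) (measurableTypeR R))).
have Fk0 (x : borelC R * R) : 0 <= fejer N x.1 (expi x.2) * kap n x.1.
  by rewrite mulr_ge0// fejer_ge0.
have mG : measurable_fun (circle : set (borelC R)) G.
  exact: (measurable_integral_r leb mc mS mFk Fk0).
have GE z : G z = ((kap n z)%:E * \int[leb]_(t in S) (fejer N z (expi t))%:E)%E.
  rewrite /G -ge0_integralZl_EFin//.
  - by apply: eq_integral => t _; rewrite -EFinM mulrC.
  - by move=> t _; rewrite lee_fin fejer_ge0.
  - exact: (measurable_funTS (mF z)).
have G0 z : (0 <= G z)%E.
  by apply: integral_ge0 => t _; rewrite lee_fin mulr_ge0// fejer_ge0.
have GI : (\int[mu]_(z in circle) G z <= ((1 + e2)%:E * leb S)%E)%E.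
  rewrite (tonelli_in mu leb mc mS mFk Fk0) -integral_cst//.
  apply: ge0_le_integral => //.
  - by move=> t _; apply: integral_ge0 => z _; rewrite lee_fin mulr_ge0// fejer_ge0.
  - exact: (measurable_integral_l mu mc mS mFk Fk0).
  - by move=> t _ /=; apply: Hn; exact: circle_expi.
rewrite -ge0_integralZl_EFin; [|exact: mI|by move=> z _; rewrite lee_fin|exact: mkap|exact: ltW].
apply: (@le_trans _ _ (\int[mu]_(z in circle) (G z + (e / 3)%:E * (kap n z)%:E))%E).
  apply: (@le_trans _ _ (\int[mu]_(z in I) (G z + (e / 3)%:E * (kap n z)%:E))%E).
    apply: ge0_le_integral => //.
    - by move=> z _; rewrite mule_ge0// lee_fin// ltW.
    - exact: measurable_funeM.
    - apply: emeasurable_funD; last exact: measurable_funeM.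
      by apply: measurable_funS mG => //; exact: arc_sub_circle.
    - move=> z Iz; rewrite GE muleC [X in (_ + X)%E]muleC -ge0_muleDr ?lee_fin ?(ltW e3)//.
        by apply: lee_wpmul2l; [rewrite lee_fin|exact: split].
      by apply: integral_ge0 => t _; rewrite lee_fin fejer_ge0.
  apply: ge0_subset_integral => //.
  - by apply: emeasurable_funD => //; exact: measurable_funeM.
  - by move=> z _; rewrite adde_ge0// mule_ge0// lee_fin// ltW.
  - exact: arc_sub_circle.
rewrite ge0_integralD//; last 2 first.
- by move=> z _; rewrite mule_ge0// lee_fin// ltW.
- exact: measurable_funeM.
rewrite ge0_integralZl_EFin; [|exact: mc|by move=> z _; rewrite lee_fin|exact: mkap|exact: ltW].
rewrite integral_cd_mean// mule1.
apply: (le_trans (leeD2r _ GI)).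
have mT := measurable_angles mI.
set T := period `&` _ in leS mT *.
have fT : leb T \is a fin_num by apply: lebesgue_sub_period => //; exact: subIsetl.
have fS : leb S \is a fin_num by exact: lebesgue_sub_period.
have T2 : (leb T <= (2 * pi)%:E)%E.
  by rewrite -lebesgue_period; apply: le_measure; rewrite ?inE//; exact: subIsetl.
move: leS T2; rewrite -(fineK fT) -(fineK fS) -!EFinM -!EFinD !lee_fin.
set x := fine (leb S); set y := fine (leb T) => xy y2.
have e2x : e2 * x <= e / 3.
  by rewrite /e2 -mulrA ler_piMr ?(ltW e3)// mulrC ler_pdivrMr// mul1r /b; lra.
by rewrite [_ * x]mulrDl mul1r; lra.
Qed.

End ArcUpperBound.

(** * Fejer means as an approximate identity in mean *)

Section NonnegativeLimits.
Variable R : realType.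

Lemma cvge0P (u : nat -> \bar R) : (forall n, (0 <= u n)%E) ->
  (u n @[n --> \oo] --> 0%E) <->
  (forall e : R, 0 < e -> \forall n \near \oo, (u n <= e%:E)%E).
Proof.
move=> u0; split=> [/fine_cvgP[fin /cvgrPdist_le H] e e0|H].
  apply: filterS2 fin (H e e0) => n uf; rewrite sub0r normrN ger0_norm ?fine_ge0//=.
  by rewrite -lee_fin fineK.
apply/fine_cvgP; split.
  apply: filterS (H 1 ltr01) => n un.
  by rewrite ge0_fin_numE//; exact: le_lt_trans un (ltry _).
apply/cvgrPdist_le => e e0; apply: filterS (H e e0) => n un.
have uf : u n \is a fin_num by rewrite ge0_fin_numE//; exact: le_lt_trans un (ltry _).
by rewrite /= sub0r normrN ger0_norm ?fine_ge0// -lee_fin fineK.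
Qed.

End NonnegativeLimits.

Section BoundedConvergence.
Context d (T : measurableType d) (R : realType).
Variables (m : {measure set T -> \bar R}) (D : set T).
Hypotheses (mD : measurable D) (Dfin : (m D < +oo)%E).

Lemma bounded_convergence0 (Q : nat -> T -> \bar R) (C : R) :
  (forall n, measurable_fun D (Q n)) ->
  (forall n x, D x -> (0 <= Q n x <= C%:E)%E) ->
  {ae m, forall x, D x ->
     forall e : R, 0 < e -> \forall n \near \oo, (Q n x <= e%:E)%E} ->
  forall e : R, 0 < e -> \forall n \near \oo, (\int[m]_(x in D) Q n x <= e%:E)%E.
Proof.
move=> mQ bQ cQ.
have Q0 n : (0 <= \int[m]_(x in D) Q n x)%E.
  by apply: integral_ge0 => x Dx; have /andP[] := bQ n x Dx.
apply/(cvge0P Q0).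
have [] := @dominated_convergence _ _ _ m D mD Q (cst 0%E) (cst C%:E) mQ.
- exact: measurable_cst.
- apply: filterS cQ => x H Dx; apply/cvge0P; last exact: H.
  by move=> n; have /andP[] := bQ n x Dx.
- apply/integrableP; split; first exact: measurable_cst.
  under eq_integral do rewrite /cst /=.
  by rewrite integral_cst// lte_mul_pinfty.
- apply: aeW => x n Dx; have /andP[q0 qC] := bQ n x Dx.
  by rewrite gee0_abs.
by move=> _ _; rewrite integral0.
Qed.

End BoundedConvergence.

Section FejerOscillation.
Variable R : realType.
Local Notation leb := (@lebesgue_measure R).
Local Notation period := (@period R).
Local Notation mP := (@measurable_period R).
Implicit Types (f g w : R -> R) (s t : R).

(** This dominates the error of the Fejer mean of [f] at [t]; being the integral
    of a nonnegative function, it is at once accessible to Tonelli. *)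
Definition fejer_osc n f t : \bar R :=
  (\int[leb]_(s in period) (fejer n (expi s) (expi t) * `|f s - f t|)%:E)%E.

Lemma lebesgue_period_lty : (leb period < +oo)%E.
Proof. by rewrite lebesgue_period ltry. Qed.

Lemma measurable_fejer_pair n : measurable_fun setT
  (fun x : R * R => fejer n (expi x.1) (expi x.2)).
Proof.
apply: measurable_fejer.
  exact: (mcplx_comp (@measurable_fst _ _ (measurableTypeR R) (measurableTypeR R)) (@mcplx_expi R)).
exact: (mcplx_comp (@measurable_snd _ _ (measurableTypeR R) (measurableTypeR R)) (@mcplx_expi R)).
Qed.

Lemma integral_fejerl n t :
  (\int[leb]_(s in period) (fejer n (expi s) (expi t))%:E = (2 * pi)%:E)%E.
Proof.
rewrite -(integral_fejer n (circle_expi t)).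
by apply: eq_integral => s _; rewrite fejerC.
Qed.

Let mfst f : measurable_fun setT f -> measurable_fun setT (fun x : R * R => f x.1).
Proof.
move=> mf.
exact: (measurableT_comp mf (@measurable_fst _ _ (measurableTypeR R) (measurableTypeR R))).
Qed.

Let msnd f : measurable_fun setT f -> measurable_fun setT (fun x : R * R => f x.2).
Proof.
move=> mf.
exact: (measurableT_comp mf (@measurable_snd _ _ (measurableTypeR R) (measurableTypeR R))).
Qed.

Let mosc n f : measurable_fun setT f -> measurable_fun setT
  (fun x : R * R => fejer n (expi x.1) (expi x.2) * `|f x.1 - f x.2|).
Proof.
move=> mf; apply: measurable_funM; first exact: measurable_fejer_pair.
apply: measurableT_comp => //; apply: measurable_funB; [exact: mfst|exact: msnd].
Qed.

Let osc0 n f (x : R * R) : 0 <= fejer n (expi x.1) (expi x.2) * `|f x.1 - f x.2|.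
Proof. by rewrite mulr_ge0// fejer_ge0. Qed.

Lemma measurable_fejer_osc n f : measurable_fun setT f ->
  measurable_fun period (fejer_osc n f).
Proof.
by move=> mf; exact: (measurable_integral_l leb mP mP (mosc n mf) (osc0 n f)).
Qed.

Lemma fejer_osc_ge0 n f t : (0 <= fejer_osc n f t)%E.
Proof. by apply: integral_ge0 => s _; rewrite lee_fin (osc0 n f (s, t)). Qed.

Lemma fejer_osc_bounded n g (M : R) t : measurable_fun setT g ->
  (forall s, period s -> `|g s| <= M) -> period t ->
  (fejer_osc n g t <= (4 * pi * M)%:E)%E.
Proof.
move=> mg gM pt.
have M0 : 0 <= M by apply: le_trans (gM t pt).
have mF : measurable_fun period (fun s : R => (fejer n (expi s) (expi t))%:E).
  apply/measurable_EFinP; apply: measurable_funTS; apply: measurable_fejer.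
    exact: mcplx_expi.
  exact: mcplx_cst.
apply: (@le_trans _ _ (\int[leb]_(s in period) ((2 * M)%:E * (fejer n (expi s) (expi t))%:E))%E).
  apply: ge0_le_integral => //.
  - exact: mP.
  - by move=> s _; rewrite lee_fin (osc0 n g (s, t)).
  - apply/measurable_EFinP; apply: measurable_funTS.
    exact: (measurableT_comp (mosc n mg)
      (@pair2_measurable _ _ (measurableTypeR R) (measurableTypeR R) t)).
  - exact: measurable_funeM.
  - move=> s ps; rewrite -EFinM lee_fin mulrC ler_wpM2r ?fejer_ge0//.
    apply: (le_trans (ler_normB _ _)).
    by have := gM s ps; have := gM t pt; lra.
rewrite ge0_integralZl_EFin//; last 3 first.
- exact: mP.
- by move=> s _; rewrite lee_fin fejer_ge0.
- by rewrite mulr_ge0.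
by rewrite integral_fejerl -EFinM lee_fin; lra.
Qed.

End FejerOscillation.

Section FejerApproximation.
Variable R : realType.
Local Notation leb := (@lebesgue_measure R).
Local Notation period := (@period R).
Local Notation mP := (@measurable_period R).
Implicit Types (f g w : R -> R) (s t : R).

Lemma continuous_bounded_period g : continuous g ->
  exists2 M : R, 0 <= M & forall s, period s -> `|g s| <= M.
Proof.
move=> cg.
have cI : compact (g @` `[0, 2 * pi]).
  apply: continuous_compact; last exact: segment_compact.
  exact: continuous_subspaceT.
have [M [Mr HM]] := compact_bounded cI.
exists (`|M| + 1) => [|s ps]; first by rewrite addr_ge0.
apply: HM; first by rewrite ltr_pwDr// ler_norm.
exists s => //; move: ps; rewrite /Defs.period /= !in_itv /=.
by move=> /andP[-> /ltW ->].
Qed.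

(** Only at interior angles: a continuous function of the angle need not take the
    same value at the two ends of the period. *)
Lemma fejer_osc_lim g t : continuous g -> 0 < t < 2 * pi ->
  forall e : R, 0 < e -> \forall n \near \oo, (fejer_osc n g t <= e%:E)%E.
Proof.
move=> cg /andP[t0 t2] e e0.
have pi0 : 0 < 2 * pi :> R by rewrite mulr_gt0// pi_gt0.
have pt : period t by rewrite /Defs.period /= in_itv /= (ltW t0).
pose e1 := e / 2 / (2 * pi).
have e10 : 0 < e1 by rewrite !divr_gt0.
have /cvgrPdist_le/(_ e1 e10)/nbhs_ballP[r /= r0 rg] := cg t.
have [d d0 Ud] : exists2 d : R, 0 < d & forall s, period s -> ~ ball t r s ->
    d <= nsq (expi t - expi s).
  apply: expi_sep => //; first exact: ball_open.
    exact: ballxx.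
  by move=> tz; rewrite tz ltxx in t0.
have [M M0 gM] := continuous_bounded_period cg.
have := nbhs_infty_div_le (2 * M * (8 * pi / d)) (divr_gt0 e0 (ltr0n _ 2)).
apply: filterS => n Hn.
have mg : measurable_fun setT g by exact: continuous_measurable_fun.
have mF : measurable_fun setT (fun s : R => (fejer n (expi t) (expi s))%:E).
  by apply/measurable_EFinP; exact: measurable_fejer_angle.
have mFg : measurable_fun setT
    (fun s : R => (fejer n (expi t) (expi s) * `|g s - g t|)%:E).
  apply/measurable_EFinP; apply: measurable_funM.
    exact: measurable_fejer_angle.
  by apply: measurableT_comp => //; exact: measurable_funB.
have mB : measurable (ball t r : set R) by apply: open_measurable; exact: ball_open.
have mPB : measurable (period `&` ball t r) by exact: (measurableI _ _ mP mB).
have mPD : measurable (period `\` ball t r) by exact: (measurableD mP mB).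
rewrite /fejer_osc; under eq_integral do rewrite fejerC.
rewrite -(setUIDK period (ball t r)) ge0_integral_setU//; last 3 first.
- exact: (measurable_funTS mFg).
- by move=> s _; rewrite lee_fin mulr_ge0// fejer_ge0.
- by apply/disj_setPS => s [[_ Bs] []].
have -> : e%:E = ((e / 2)%:E + (e / 2)%:E)%E by rewrite -EFinD; congr EFin; lra.
apply: leeD.
  apply: (@le_trans _ _ (\int[leb]_(s in period `&` ball t r)
      (e1%:E * (fejer n (expi t) (expi s))%:E))%E).
    apply: ge0_le_integral => //.
    - by move=> s _; rewrite lee_fin mulr_ge0// fejer_ge0.
    - exact: (measurable_funTS mFg).
    - by apply: measurable_funeM; exact: (measurable_funTS mF).
    - move=> s [_ Bs]; rewrite -EFinM lee_fin mulrC ler_wpM2r ?fejer_ge0//.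
      by rewrite distrC; exact: rg.
  rewrite ge0_integralZl_EFin; [|exact: mPB
    |by move=> s _; rewrite lee_fin fejer_ge0
    |exact: (measurable_funTS mF)|exact: ltW].
  apply: (@le_trans _ _ (e1%:E * (2 * pi)%:E)%E).
    apply: lee_wpmul2l; first by rewrite lee_fin ltW.
    by apply: integral_fejer_sub => //; exact: circle_expi.
  by rewrite -EFinM lee_fin /e1 divfK// gt_eqF.
apply: (@le_trans _ _ (\int[leb]_(s in period `\` ball t r)
    ((2 * M)%:E * (fejer n (expi t) (expi s))%:E))%E).
  apply: ge0_le_integral => //.
  - by move=> s _; rewrite lee_fin mulr_ge0// fejer_ge0.
  - exact: (measurable_funTS mFg).
  - by apply: measurable_funeM; exact: (measurable_funTS mF).
  - move=> s [ps _]; rewrite -EFinM lee_fin mulrC ler_wpM2r ?fejer_ge0//.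
    apply: (le_trans (ler_normB _ _)).
    by have := gM s ps; have := gM t pt; lra.
rewrite ge0_integralZl_EFin; [|exact: mPD
  |by move=> s _; rewrite lee_fin fejer_ge0
  |exact: (measurable_funTS mF)|by rewrite mulr_ge0].
apply: (@le_trans _ _ ((2 * M)%:E * (8 * pi / d / n.+1%:R)%:E)%E).
  apply: lee_wpmul2l; first by rewrite lee_fin mulr_ge0.
  apply: integral_fejer_away => //; first exact: circle_expi.
  by move=> s [ps nB]; exact: Ud.
by rewrite -EFinM lee_fin mulrA.
Qed.

Lemma fejer_osc_continuous g (e : R) : continuous g -> 0 < e ->
  \forall n \near \oo, (\int[leb]_(t in period) fejer_osc n g t <= e%:E)%E.
Proof.
move=> cg e0.
have mg : measurable_fun setT g by exact: continuous_measurable_fun.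
have [M M0 gM] := continuous_bounded_period cg.
move: e e0; apply: (@bounded_convergence0 _ _ _ leb period mP (lebesgue_period_lty R)
  (fun n => fejer_osc n g) (4 * pi * M)).
- by move=> n; exact: measurable_fejer_osc.
- by move=> n t pt; rewrite fejer_osc_ge0 fejer_osc_bounded.
- exists [set 0]; split => //; first exact: lebesgue_measure_set1.
  move=> t /= nt; apply: contrapT => tn0; apply: nt => pt.
  apply: fejer_osc_lim => //; move: pt; rewrite /Defs.period /= in_itv /=.
  by move=> /andP[t0 ->]; rewrite andbT lt_def t0 andbT; exact/eqP.
Qed.

Lemma fejer_osc_triangle n f g : measurable_fun setT f -> measurable_fun setT g ->
  (\int[leb]_(t in period) fejer_osc n f t <=
   \int[leb]_(t in period) fejer_osc n g t +
   (4 * pi)%:E * \int[leb]_(t in period) `|f t - g t|%:E)%E.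
Proof.
move=> mf mg.
pose K (x : R * R) := fejer n (expi x.1) (expi x.2).
have K0 x : 0 <= K x by exact: fejer_ge0.
pose D t := `|f t - g t|.
have mD : measurable_fun setT D by apply: measurableT_comp => //; exact: measurable_funB.
have mK : measurable_fun setT K := @measurable_fejer_pair R n.
have mD1 : measurable_fun setT (fun x : R * R => K x * D x.1).
  apply: measurable_funM => //.
  exact: (measurableT_comp mD (@measurable_fst _ _ (measurableTypeR R) (measurableTypeR R))).
have mD2 : measurable_fun setT (fun x : R * R => K x * D x.2).
  apply: measurable_funM => //.
  exact: (measurableT_comp mD (@measurable_snd _ _ (measurableTypeR R) (measurableTypeR R))).
have D0 t : 0 <= D t by exact: normr_ge0.
have KD1 (x : R * R) : 0 <= K x * D x.1 by rewrite mulr_ge0.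
have KD2 (x : R * R) : 0 <= K x * D x.2 by rewrite mulr_ge0.
have mEg := measurable_fejer_osc n mg.
have m1 := measurable_integral_l leb mP mP mD1 KD1.
have m2 := measurable_integral_l leb mP mP mD2 KD2.
have pi0 : 0 < 2 * pi :> R by rewrite mulr_gt0// pi_gt0.
have I1 : (\int[leb]_(t in period) \int[leb]_(s in period) (K (s, t) * D s)%:E =
    (2 * pi)%:E * \int[leb]_(t in period) (D t)%:E)%E.
  rewrite -(tonelli_in leb leb mP mP mD1 KD1) -ge0_integralZl_EFin; [|exact: mP
    |by move=> s _; rewrite lee_fin
    |by apply/measurable_EFinP; exact: (measurable_funTS mD)|exact: ltW].
  apply: eq_integral => s _ /=.
  rewrite -(integral_fejer n (circle_expi s)) muleC -ge0_integralZl_EFin; [|exact: mP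
    |by move=> t _; rewrite lee_fin fejer_ge0
    |by apply/measurable_EFinP; apply: measurable_funTS; exact: measurable_fejer_angle
    |exact: D0].
  by apply: eq_integral => t _; rewrite -EFinM mulrC.
have I2 : (\int[leb]_(t in period) \int[leb]_(s in period) (K (s, t) * D t)%:E =
    (2 * pi)%:E * \int[leb]_(t in period) (D t)%:E)%E.
  rewrite -ge0_integralZl_EFin; [|exact: mP
    |by move=> s _; rewrite lee_fin
    |by apply/measurable_EFinP; exact: (measurable_funTS mD)|exact: ltW].
  apply: eq_integral => t _ /=.
  rewrite -(integral_fejerl n t) muleC -ge0_integralZl_EFin; [|exact: mP
    |by move=> s _; rewrite lee_fin fejer_ge0
    |
    |exact: D0].
    by apply: eq_integral => s _; rewrite -EFinM mulrC.
  apply/measurable_EFinP; apply: measurable_funTS; apply: measurable_fejer.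
    exact: mcplx_expi.
  exact: mcplx_cst.
have sec (h : R * R -> R) t : measurable_fun setT h ->
    measurable_fun period (fun s : R => (h (s, t))%:E).
  move=> mh; apply/measurable_EFinP; apply: measurable_funTS.
  exact: (measurableT_comp mh (@pair2_measurable _ _ (measurableTypeR R) (measurableTypeR R) t)).
have mKg : measurable_fun setT (fun x : R * R => K x * `|g x.1 - g x.2|).
  apply: measurable_funM => //; apply: measurableT_comp => //; apply: measurable_funB.
    exact: (measurableT_comp mg (@measurable_fst _ _ (measurableTypeR R) (measurableTypeR R))).
  exact: (measurableT_comp mg (@measurable_snd _ _ (measurableTypeR R) (measurableTypeR R))).
have mKf : measurable_fun setT (fun x : R * R => K x * `|f x.1 - f x.2|).
  apply: measurable_funM => //; apply: measurableT_comp => //; apply: measurable_funB.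
    exact: (measurableT_comp mf (@measurable_fst _ _ (measurableTypeR R) (measurableTypeR R))).
  exact: (measurableT_comp mf (@measurable_snd _ _ (measurableTypeR R) (measurableTypeR R))).
have -> : ((4 * pi)%:E * \int[leb]_(t in period) (D t)%:E =
    (2 * pi)%:E * \int[leb]_(t in period) (D t)%:E +
    (2 * pi)%:E * \int[leb]_(t in period) (D t)%:E)%E.
  rewrite -ge0_muleDl ?lee_fin ?(ltW pi0)// -EFinD; congr (_%:E * _)%E; lra.
rewrite -{1}I1 -I2.
have J0 (h : R * R -> R) t : (forall x, 0 <= h x) ->
    (0 <= \int[leb]_(s in period) (h (s, t))%:E)%E.
  by move=> h0; apply: integral_ge0 => s _; rewrite lee_fin.
rewrite -ge0_integralD; [|exact: mP|by move=> t _; exact: (J0 _ t KD1)|exact: m1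
  |by move=> t _; exact: (J0 _ t KD2)|exact: m2].
rewrite -ge0_integralD; [|exact: mP|by move=> t _; exact: fejer_osc_ge0|exact: mEg
  |by move=> t _; rewrite adde_ge0//; [exact: (J0 _ t KD1)|exact: (J0 _ t KD2)]
  |exact: emeasurable_funD].
apply: ge0_le_integral.
- exact: mP.
- by move=> t _; exact: fejer_osc_ge0.
- exact: measurable_fejer_osc.
- by apply: emeasurable_funD => //; exact: emeasurable_funD.
move=> t _.
rewrite -ge0_integralD; [|exact: mP|by move=> s _; rewrite lee_fin; exact: (KD1 (s, t))
  |exact: (sec _ t mD1)|by move=> s _; rewrite lee_fin; exact: (KD2 (s, t))
  |exact: (sec _ t mD2)].
rewrite -ge0_integralD; [|exact: mP
  |by move=> s _; rewrite lee_fin mulr_ge0// fejer_ge0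
  |exact: (sec _ t mKg)
  |by move=> s _; rewrite -EFinD lee_fin addr_ge0
  |apply: emeasurable_funD; [exact: (sec _ t mD1)|exact: (sec _ t mD2)]].
apply: ge0_le_integral.
- exact: mP.
- by move=> s _; rewrite lee_fin mulr_ge0// fejer_ge0.
- exact: (sec _ t mKf).
- apply: emeasurable_funD; first exact: (sec _ t mKg).
  by apply: emeasurable_funD; [exact: (sec _ t mD1)|exact: (sec _ t mD2)].
move=> s _; have k0 : 0 <= fejer n (expi s) (expi t) by exact: fejer_ge0.
have fg : `|f s - f t| <= `|g s - g t| + (D s + D t).
  have -> : f s - f t = (g s - g t) + ((f s - g s) + (g t - f t)) by ring.
  apply: (le_trans (ler_normD _ _)); rewrite lerD2l.
  by apply: (le_trans (ler_normD _ _)); rewrite /D (distrC (f t)).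
have := ler_wpM2l k0 fg; rewrite !mulrDr => H.
by rewrite -!EFinD lee_fin; exact: H.
Qed.

(** Continuous functions are dense in mean, the triangle inequality costs a fixed
    multiple of the distance, and for continuous functions bounded pointwise
    convergence suffices. *)
Lemma fejer_osc_cvg w (e : R) : measurable_fun setT w ->
  leb.-integrable period (EFin \o w) -> 0 < e ->
  \forall n \near \oo, (\int[leb]_(t in period) fejer_osc n w t <= e%:E)%E.
Proof.
move=> mw iw e0.
have e2 : 0 < e / 2 by rewrite divr_gt0.
have pi0 : 0 < 4 * pi :> R by rewrite mulr_gt0// pi_gt0.
have [g_ [cg ig /fine_cvgP[fg /cvgrPdist_le]]] :=
  approximation_continuous_integrable mP (lebesgue_period_lty R) iw.
move=> /(_ _ (divr_gt0 e2 pi0)) H.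
have [k [kf kH]] : exists k, (\int[leb]_(z in period) `|(w z - g_ k z)%:E|)%E \is a fin_num /\
    `|0 - fine (\int[leb]_(z in period) `|(w z - g_ k z)%:E|)%E| <= e / 2 / (4 * pi).
  have [k [h1 h2]] := filter_ex (filterI fg H).
  by exists k.
have := fejer_osc_continuous (cg k) e2; apply: filterS => n Hn.
have mg : measurable_fun setT (g_ k) by exact: continuous_measurable_fun (cg k).
apply: (le_trans (fejer_osc_triangle n mw mg)).
have -> : e%:E = ((e / 2)%:E + (e / 2)%:E)%E by rewrite -EFinD; congr EFin; lra.
apply: leeD => //.
move: kH; rewrite sub0r normrN ger0_norm; last first.
  by apply: fine_ge0; apply: integral_ge0.
rewrite -lee_fin fineK// => kH.
apply: (@le_trans _ _ ((4 * pi)%:E * (e / 2 / (4 * pi))%:E)%E).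
  by apply: lee_wpmul2l => //; rewrite lee_fin ltW.
by rewrite -EFinM lee_fin mulrC divfK// gt_eqF.
Qed.

End FejerApproximation.

(** * Lower bound for the kernel *)

Section LowerBound.
Variable R : realType.
Variable mu mus : {finite_measure set (borelC R) -> \bar R}.
Variables (Phi : nat -> {poly R[i]}) (w : R -> R).
Hypothesis mu_circle : on_circle mu.
Hypothesis mu_inf : infinite_set (msupport mu).
Hypothesis OP : monic_OPs mu Phi.
Hypothesis mw : measurable_fun setT w.
Hypothesis w0 : forall t, 0 <= w t.
Hypothesis dec : lebesgue_decomposition mu w mus.
Implicit Types (z u : R[i]) (s t : R).

Local Notation circle := (@circle R).
Local Notation leb := (@lebesgue_measure R).
Local Notation kap := (cd_mean mu Phi).
Local Notation period := (@period R).
Local Notation mP := (@measurable_period R).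
Local Notation mc := (@measurable_circle R).

Let pi0 : 0 < 2 * pi :> R. Proof. by rewrite mulr_gt0// pi_gt0. Qed.

Lemma integrable_density : leb.-integrable period (EFin \o w).
Proof.
have [_ _ _ /(_ setT measurableT)] := dec.
rewrite preimage_setT setIT => muE.
apply/integrableP; split; first by apply/measurable_EFinP; exact: measurable_funTS.
have -> : (\int[leb]_(t in period) `|(EFin \o w) t| =
    (2 * pi)%:E * \int[leb]_(t in period) (w t / (2 * pi))%:E)%E.
  rewrite -ge0_integralZl_EFin; [|exact: mP
    |by move=> t _; rewrite lee_fin divr_ge0// ltW
    |by apply/measurable_EFinP; apply: measurable_funTS; exact: measurable_funM
    |exact: ltW].
  apply: eq_integral => t _ /=.
  by rewrite ger0_norm// -EFinM mulrC divfK// gt_eqF.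
rewrite lte_mul_pinfty ?lee_fin ?(ltW pi0)//.
apply: (@le_lt_trans _ _ (mu setT)).
  by rewrite muE leeDl.
by rewrite ltey_eq fin_num_measure.
Qed.

(** The Fejer mean of the singular part. *)
Definition fejer_singular n t : \bar R :=
  (\int[mus]_(z in circle) (fejer n z (expi t))%:E)%E.

Lemma fejer_singular_ge0 n t : (0 <= fejer_singular n t)%E.
Proof. by apply: integral_ge0 => z _; rewrite lee_fin fejer_ge0. Qed.

Lemma integral_fejer_measure_le n t :
  (\int[mu]_(z in circle) (fejer n z (expi t))%:E <=
   (w t)%:E + ((2 * pi)^-1%:E * fejer_osc n w t + fejer_singular n t))%E.
Proof.
rewrite (integral_decomposition_in dec mc (measurable_fejer_point n (expi t))); last first.
  by move=> z; exact: fejer_ge0.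
have -> : period `&` (@expi R) @^-1` circle = period.
  by apply/setIidl => s _; exact: circle_expi.
rewrite -/(fejer_singular n t) [leRHS]addeA; apply: leeD2r.
have mF : measurable_fun setT (fun s => fejer n (expi s) (expi t)).
  by apply: measurable_fejer; [exact: mcplx_expi|exact: mcplx_cst].
have mD : measurable_fun setT (fun s => fejer n (expi s) (expi t) * `|w s - w t|).
  by apply: measurable_funM => //; apply: measurableT_comp => //; exact: measurable_funB.
have F0 s : 0 <= fejer n (expi s) (expi t) by exact: fejer_ge0.
have wpi : 0 <= w t / (2 * pi) by rewrite divr_ge0// ltW.
have -> : (w t)%:E = (\int[leb]_(s in period)
    ((w t / (2 * pi))%:E * (fejer n (expi s) (expi t))%:E))%E.
  rewrite ge0_integralZl_EFin; [|exact: mP|by move=> s _; rewrite lee_fin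
    |by apply/measurable_EFinP; exact: measurable_funTS|by []].
  by rewrite integral_fejerl -EFinM divfK// gt_eqF.
rewrite /fejer_osc -ge0_integralZl_EFin; [|exact: mP
  |by move=> s _; rewrite lee_fin mulr_ge0
  |by apply/measurable_EFinP; exact: measurable_funTS|by rewrite invr_ge0 ltW].
rewrite -ge0_integralD; [|exact: mP
  |by move=> s _; rewrite -EFinM lee_fin mulr_ge0
  |by apply: measurable_funeM; apply/measurable_EFinP; exact: measurable_funTS
  |by move=> s _; rewrite -EFinM lee_fin mulr_ge0// ?invr_ge0 ?(ltW pi0)// mulr_ge0
  |by apply: measurable_funeM; apply/measurable_EFinP; exact: measurable_funTS].
apply: ge0_le_integral.
- exact: mP.
- by move=> s _; rewrite lee_fin mulr_ge0// divr_ge0// ltW.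
- apply/measurable_EFinP; apply: measurable_funTS; apply: measurable_funM => //.
  exact: measurable_funM.
- apply: emeasurable_funD; apply: measurable_funeM; apply/measurable_EFinP;
    exact: measurable_funTS.
move=> s _; rewrite -!EFinM -EFinD lee_fin.
have := F0 s; set k := fejer _ _ _ => k0.
have -> : w t / (2 * pi) * k + (2 * pi)^-1 * (k * `|w s - w t|) =
  k * ((w t + `|w s - w t|) / (2 * pi)) by ring.
apply: ler_wpM2l => //; apply: ler_wpM2r; first by rewrite invr_ge0 ltW.
by rewrite -lerBlDl ler_norm.
Qed.

(** The Fejer kernel is the squared modulus of a polynomial which is admissible
    in the variational bound on the kernel. *)
Lemma christoffel_fejer n t : exists2 a : R,
  (a%:E = \int[mu]_(z in circle) (fejer n z (expi t))%:E)%E &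
  1 <= kap n (expi t) * a.
Proof.
pose p : {poly R[i]} := \poly_(j < n.+1) ((n.+1%:R^-1)%:C%C * (expi t)^* ^+ j).
have pE z : p.[z] = (n.+1%:R^-1)%:C%C * \sum_(j < n.+1) (z * (expi t)^*) ^+ j.
  rewrite horner_poly mulr_sumr; apply: eq_bigr => j _.
  by rewrite exprMn; ring.
have n0 : (n.+1%:R : R) != 0 by rewrite pnatr_eq0.
exists (n.+1%:R * sqnorm mu p).
  rewrite EFinM EFin_sqnorm -ge0_integralZl_EFin; [|exact: mc
    |by move=> z _; rewrite lee_fin nsq_ge0
    |apply/measurable_EFinP; apply: measurable_funTS; exact: measurable_nsq (mcplx_poly p)
    |by []].
  apply: eq_integral => z _; rewrite -EFinM; congr EFin.
  by rewrite pE nsqM nsqR /fejer; field; rewrite nat1r.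
have p1 : p.[expi t] = 1.
  rewrite pE mulCJ nsq_expi (eq_bigr (fun=> 1)) => [|j _]; last by rewrite expr1n.
  rewrite sumr_const card_ord.
  have -> : (1 : R[i]) *+ n.+1 = (n.+1%:R : R)%:C%C by rewrite rmorph_nat.
  by rewrite -rmorphM mulVf// rmorph1.
have := christoffel mu_circle mu_inf OP (size_poly _ _) p1.
by rewrite /cd_mean mulrACA mulVf// mul1r.
Qed.

(** The normalized kernel is at least the reciprocal of the Fejer mean of the
    measure, so where it falls short of the reciprocal of the density, that mean
    exceeds the density. *)
Lemma defect_le n t (d : R) : 0 < d -> d <= w t ->
  ((Num.max 0 (1 - w t * kap n (expi t)))%:E <=
   d^-1%:E * ((2 * pi)^-1%:E * fejer_osc n w t + fejer_singular n t))%E.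
Proof.
move=> d0 dw.
have [a aE ka] := christoffel_fejer n t.
have k0 : 0 <= kap n (expi t) by exact: cd_mean_ge0.
have := integral_fejer_measure_le n t; rewrite -aE.
have : (0 <= (2 * pi)^-1%:E * fejer_osc n w t + fejer_singular n t)%E.
  rewrite adde_ge0 ?fejer_singular_ge0// mule_ge0 ?fejer_osc_ge0//.
  by rewrite lee_fin invr_ge0 ltW.
have di0 : 0 < d^-1 by rewrite invr_gt0.
move: (_ + fejer_singular _ _)%E => [e| |]//; last first.
  by move=> _ _; rewrite gt0_muley ?lte_fin// leey.
rewrite -EFinD -EFinM !lee_fin => e0 awe.
have [h|h] := leP (1 - w t * kap n (expi t)) 0.
  by rewrite mulr_ge0// ltW.
have wt0 : 0 < w t by exact: lt_le_trans d0 dw.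
have kd : kap n (expi t) <= d^-1.
  rewrite -[leRHS]mul1r ler_pdivlMr//.
  apply: (@le_trans _ _ (kap n (expi t) * w t)); first by rewrite ler_wpM2l.
  by rewrite mulrC; lra.
have H : kap n (expi t) * a <= kap n (expi t) * (w t + e) by rewrite ler_wpM2l.
apply: (@le_trans _ _ (kap n (expi t) * e)).
  by move: H; rewrite mulrDr [_ * w t]mulrC; lra.
by rewrite ler_wpM2r.
Qed.

Lemma measurable_fejer_singular n : measurable_fun period (fejer_singular n).
Proof.
apply: (measurable_integral_l mus mc mP (@measurable_fejer2 R n)) => x.
exact: fejer_ge0.
Qed.

(** The singular part lives over a null set of angles, which has small open
    neighbourhoods [U]. After Tonelli, the inner integral is the Fejer mean of the
    indicator of the complement of [U] at a point of that null set, and tends to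
    zero boundedly. *)
Lemma fejer_singular_cvg (e : R) : 0 < e -> exists U : set R,
  [/\ measurable U, (leb U <= e%:E)%E & forall e' : R, 0 < e' ->
    \forall n \near \oo,
      (\int[leb]_(t in period `\` U) fejer_singular n t <= e'%:E)%E].
Proof.
move=> e0; have [_ _ [N [mN musN lebN]] _] := dec.
(* both ends of the period, so that [U] also surrounds the point 1 *)
pose Z := (period `&` (@expi R) @^-1` N) `|` ([set 0] `|` [set 2 * pi]).
have mZ : measurable Z.
  apply: measurableU; first exact: measurable_angles.
  by apply: measurableU; exact: measurable_set1.
have lebZ : leb Z = 0%E.
  apply/eqP; rewrite eq_le measure_ge0 andbT.
  have m1 := measurable_angles mN.
  have m2 := @measurable_set1 R 0; have m3 := @measurable_set1 R (2 * pi).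
  have m4 : measurable ([set 0] `|` [set 2 * pi] : set R) by exact: measurableU.
  apply: (le_trans (measureU2 leb m1 m4)).
  rewrite [X in (X + _)%E](_ : _ = 0%E); last exact: lebN.
  rewrite add0e; apply: (le_trans (measureU2 leb m2 m3)).
  rewrite [X in (X + _)%E](_ : _ = 0%E); last exact: lebesgue_measure_set1.
  by rewrite [X in (_ + X)%E](_ : _ = 0%E) ?adde0//; exact: lebesgue_measure_set1.
have [|U [oU ZU leU]] := lebesgue_regularity_outer mZ _ e0.
  by rewrite [X in (X < _)%E](_ : _ = 0%E).
have mU : measurable U by exact: open_measurable.
exists U; split => //.
  apply: (@le_trans _ _ (leb (Z `|` (U `\` Z)))).
    by apply: le_measure; rewrite ?inE ?setDUK//.
  apply: (le_trans (measureU2 leb mZ (measurableD mU mZ))).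
  by rewrite [X in (X + _)%E](_ : _ = 0%E)// add0e ltW.
have mPU := measurableD mP mU.
pose G n (z : borelC R) := (\int[leb]_(t in period `\` U) (fejer n z (expi t))%:E)%E.
have K0 n (x : borelC R * R) : 0 <= fejer n x.1 (expi x.2) by exact: fejer_ge0.
have GE n : (\int[leb]_(t in period `\` U) fejer_singular n t =
    \int[mus]_(z in circle) G n z)%E.
  by rewrite (tonelli_in mus leb mc mPU (@measurable_fejer2 R n) (K0 n)).
suff H : forall e' : R, 0 < e' -> \forall n \near \oo,
    (\int[mus]_(z in circle) G n z <= e'%:E)%E.
  by move=> e' /H; apply: filterS => n; rewrite GE.
apply: (@bounded_convergence0 _ _ _ mus circle mc _ G (2 * pi)).
- by rewrite ltey_eq fin_num_measure//; exact: mc.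
- move=> n; exact: (measurable_integral_r leb mc mPU (@measurable_fejer2 R n) (K0 n)).
- move=> n z cz; apply/andP; split.
    by apply: integral_ge0 => t _; rewrite lee_fin fejer_ge0.
  by apply: integral_fejer_sub => //; exact: subDsetl.
- exists (~` N); split => //; first exact: measurableC.
  move=> z /= nz Nz; apply: nz => cz e' e'0.
  have [t pt tz] := expi_surj cz.
  have Ut : U t by apply: ZU; left; split => //=; rewrite tz.
  have [d d0 Ud] := expi_sep oU pt Ut (fun _ => ZU _ (or_intror (or_intror erefl))).
  have := nbhs_infty_div_le (8 * pi / d) e'0; apply: filterS => n Hn.
  apply: (le_trans (integral_fejer_away n cz mPU (@subDsetl _ _ _) d0 _)).
    by move=> s [ps nUs]; rewrite -tz; exact: Ud.
  by rewrite lee_fin.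
Qed.

End LowerBound.

(** * Combining the two bounds *)

Section Conclusion.
Variable R : realType.
Variable mu mus : {finite_measure set (borelC R) -> \bar R}.
Variables (Phi : nat -> {poly R[i]}) (alpha : nat -> R[i]) (w : R -> R).
Variable J : interval R.
Hypothesis mu_circle : on_circle mu.
Hypothesis mu_inf : infinite_set (msupport mu).
Hypothesis OP : monic_OPs mu Phi.
Hypothesis verb : verblunsky Phi alpha.
Hypothesis reg : regular_circle alpha.
Hypothesis mw : measurable_fun setT w.
Hypothesis w0 : forall t, 0 <= w t.
Hypothesis dec : lebesgue_decomposition mu w mus.
Hypothesis w_gt0 : {ae lebesgue_measure, forall t : R,
  period t -> circle_arc J (expi t) -> 0 < w t}.
Implicit Types (z u : R[i]) (s t : R).

Local Notation circle := (@circle R).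
Local Notation leb := (@lebesgue_measure R).
Local Notation kap := (cd_mean mu Phi).
Local Notation period := (@period R).
Local Notation mP := (@measurable_period R).
Local Notation T := (period `&` (@expi R) @^-1` circle_arc J).

Let pi0 : 0 < 2 * pi :> R. Proof. by rewrite mulr_gt0// pi_gt0. Qed.

Let mT : measurable T.
Proof. by apply: measurable_angles; exact: measurable_arc. Qed.

Lemma low_density_small (e : R) : 0 < e ->
  exists2 d : R, 0 < d & (leb (T `&` [set t | (w t < d)%R]) <= e%:E)%E.
Proof.
move=> e0; pose W m := T `&` [set t | w t < m.+1%:R^-1].
have mW m : measurable (W m).
  apply: measurableI => //; rewrite -[X in measurable X]setTI.
  exact: (measurable_fun_ltr mw (measurable_cst _)).
have mcap : measurable (\bigcap_m W m) by exact: bigcapT_measurable.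
have capW : leb (\bigcap_m W m) = 0%E.
  have [Z [mZ lebZ subZ]] := w_gt0.
  apply/eqP; rewrite eq_le measure_ge0 andbT -lebZ.
  apply: le_measure; rewrite ?inE//.
  move=> t Wt; apply: subZ => /= pos; have [[pt Jt] _] := Wt 0%N I.
  have wt := pos pt Jt; have [k] := ltr_add_invr wt; rewrite add0r => kw.
  by have [_ /=] := Wt k I; move=> /lt_trans /(_ kw); rewrite ltxx.
have finW m : leb (W m) \is a fin_num.
  by apply: lebesgue_sub_period => // t [[]].
have H : (leb \o W) m @[m --> \oo] --> leb (\bigcap_m W m).
  apply: nonincreasing_cvg_mu => //.
  - by rewrite -ge0_fin_numE//; exact: finW.
  - move=> m n mn; apply/subsetPset => t [Tt wt]; split => //=.
    by apply: (lt_le_trans wt); rewrite lef_pV2 ?posrE// ler_nat ltnS.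
move: H; rewrite capW => /fine_cvgP[_ /cvgrPdist_le/(_ e e0)[m _ /(_ m (leqnn m)) Hm]].
exists m.+1%:R^-1; first by rewrite invr_gt0.
move: Hm; rewrite /= sub0r normrN ger0_norm ?fine_ge0// => Hm.
by rewrite -/(W m) -(fineK (finW m)) lee_fin.
Qed.

Let mkap n : measurable_fun setT (fun t : R => kap n (expi t)).
Proof.
have mk : measurable_fun setT (kap n : borelC R -> R) by exact: measurable_cd_mean.
exact: (measurableT_comp mk (@measurable_expi R)).
Qed.

Let kap0 n z : 0 <= kap n z. Proof. exact: cd_mean_ge0. Qed.

Definition defect n t : R := Num.max 0 (1 - w t * kap n (expi t)).

Let mdefect n : measurable_fun setT (defect n).
Proof.
apply: measurable_maxr; first exact: measurable_cst.
by apply: measurable_funB => //; exact: measurable_funM.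
Qed.

Let defect0 n t : 0 <= defect n t.
Proof. by rewrite /defect le_max lexx. Qed.

(** The neighbourhood carrying the singular part and the set of low density have
    small measure and the defect is at most 1; elsewhere it is bounded by error
    terms that tend to zero in mean. *)
Lemma defect_cvg (e : R) : 0 < e ->
  \forall n \near \oo, (\int[leb]_(t in T) (defect n t)%:E <= e%:E)%E.
Proof.
move=> e0; have e4 : 0 < e / 4 by rewrite divr_gt0.
have [U [mU leU sing]] := fejer_singular_cvg dec e4.
have [d d0 leW] := low_density_small e4.
have HS := sing (d * (e / 4)) (mulr_gt0 d0 e4).
have HO := fejer_osc_cvg mw (integrable_density mw w0 dec)
  (mulr_gt0 pi0 (mulr_gt0 d0 e4)).
near=> n.
have hS : (\int[leb]_(t in period `\` U) fejer_singular mus n t <= (d * (e / 4))%:E)%E.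
  by near: n.
have hO : (\int[leb]_(t in period) fejer_osc n w t <= (2 * pi * (d * (e / 4)))%:E)%E.
  by near: n.
set W := T `&` _ in leW.
have mW : measurable W.
  apply: measurableI => //; rewrite -[X in measurable X]setTI.
  exact: (measurable_fun_ltr mw (measurable_cst _)).
pose V := U `|` W; have mV : measurable V by exact: measurableU.
have mTV := measurableI _ _ mT mV; have mTD := measurableD mT mV.
have mPU := measurableD mP mU.
have mD : measurable_fun setT (fun t => (defect n t)%:E) by exact/measurable_EFinP.
rewrite -(setUIDK T V) ge0_integral_setU//; last 3 first.
- exact: (measurable_funTS mD).
- by move=> t _; rewrite lee_fin.
- by apply/disj_setPS => t [[_ Vt] []].
have -> : e%:E = ((e / 4)%:E + (e / 4)%:E + ((e / 4)%:E + (e / 4)%:E))%E.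
  by rewrite -!EFinD; congr EFin; lra.
apply: leeD.
  apply: (@le_trans _ _ (\int[leb]_(t in T `&` V) (cst 1%:E t))%E).
    apply: ge0_le_integral => //.
    - by move=> t _; rewrite lee_fin.
    - exact: (measurable_funTS mD).
    - move=> t _; rewrite lee_fin /defect ge_max ler01 /=.
      by rewrite lerBlDr lerDl mulr_ge0.
  rewrite integral_cst// mul1e.
  apply: (@le_trans _ _ (leb (U `|` W))).
    by apply: le_measure; rewrite ?inE// => t [].
  apply: (le_trans (measureU2 leb mU mW)).
  by apply: leeD.
have di0 : 0 <= d^-1 by rewrite invr_ge0 ltW.
have pii0 : 0 <= (2 * pi)^-1 :> R by rewrite invr_ge0 ltW.
have m1 : measurable_fun (period `\` U) (fejer_osc n w).
  exact: (measurable_funS mP (@subDsetl _ _ _) (measurable_fejer_osc n mw)).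
have m2 : measurable_fun (period `\` U) (fejer_singular mus n).
  exact: (measurable_funS mP (@subDsetl _ _ _) (measurable_fejer_singular mus n)).
pose E t := (d^-1%:E * ((2 * pi)^-1%:E * fejer_osc n w t + fejer_singular mus n t))%E.
have E0 t : (0 <= (2 * pi)^-1%:E * fejer_osc n w t + fejer_singular mus n t)%E.
  rewrite adde_ge0 ?fejer_singular_ge0// mule_ge0 ?fejer_osc_ge0//.
have mE1 : measurable_fun (period `\` U)
    (fun t => (2 * pi)^-1%:E * fejer_osc n w t + fejer_singular mus n t)%E.
  by apply: emeasurable_funD => //; exact: measurable_funeM.
have mE : measurable_fun (period `\` U) E by exact: measurable_funeM.
have sub : T `\` V `<=` period `\` U.
  by move=> t [[pt _] nV]; split => // Ut; apply: nV; left.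
apply: (@le_trans _ _ (\int[leb]_(t in T `\` V) E t)%E).
  apply: ge0_le_integral => //.
  - by move=> t _; rewrite lee_fin.
  - exact: (measurable_funTS mD).
  - exact: (measurable_funS mPU sub mE).
  - move=> t [Tt nV]; apply: defect_le => //.
    by rewrite leNgt; apply/negP => wd; apply: nV; right.
apply: (@le_trans _ _ (\int[leb]_(t in period `\` U) E t)%E).
  apply: ge0_subset_integral => // t _.
  by rewrite mule_ge0.
rewrite ge0_integralZl_EFin; [|exact: mPU|by move=> t _; exact: E0|exact: mE1|exact: di0].
rewrite ge0_integralD; [|exact: mPU
  |by move=> t _; rewrite mule_ge0 ?fejer_osc_ge0
  |exact: measurable_funeM|by move=> t _; exact: fejer_singular_ge0|exact: m2].
rewrite ge0_integralZl_EFin; [|exact: mPU|by move=> t _; exact: fejer_osc_ge0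
  |exact: m1|exact: pii0].
have hO' : (\int[leb]_(t in period `\` U) fejer_osc n w t <= (2 * pi * (d * (e / 4)))%:E)%E.
  apply: (le_trans _ hO); apply: ge0_subset_integral => //.
  - exact: mP.
  - exact: measurable_fejer_osc.
  - by move=> t _; exact: fejer_osc_ge0.
apply: (@le_trans _ _ (d^-1%:E * ((2 * pi)^-1%:E * (2 * pi * (d * (e / 4)))%:E +
    (d * (e / 4))%:E))%E).
  apply: lee_wpmul2l; first by rewrite lee_fin.
  by apply: leeD => //; apply: lee_wpmul2l; rewrite ?lee_fin.
rewrite [leLHS](_ : _ = (d^-1 * ((2 * pi)^-1 * (2 * pi * (d * (e / 4))) +
  d * (e / 4)))%:E)// -EFinD lee_fin le_eqVlt; apply/orP; left; apply/eqP.
have dn0 : d != 0 by rewrite gt_eqF.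
have pn0 : 2 * pi != 0 :> R by rewrite gt_eqF.
by rewrite (mulKf pn0) -mulrDr (mulKf dn0).
Unshelve. all: by end_near. Qed.

Definition singular_mass n : \bar R :=
  (\int[mus]_(z in circle_arc J) (kap n z)%:E)%E.

Definition density_error n : \bar R :=
  (\int[leb]_(t in T) (`|1 - w t * kap n (expi t)| / (2 * pi))%:E)%E.

Lemma singular_mass_ge0 n : (0 <= singular_mass n)%E.
Proof. by apply: integral_ge0 => z _; rewrite lee_fin. Qed.

Lemma density_error_ge0 n : (0 <= density_error n)%E.
Proof. by apply: integral_ge0 => z _; rewrite lee_fin divr_ge0// ltW. Qed.

(** Since [`|1 - x| = (x - 1) + 2 * max(0, 1 - x)], the two errors add up to the
    excess of the mass of the arc over its length, plus twice the integrated
    defect. *)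
Lemma total_error_le (e : R) : 0 < e ->
  \forall n \near \oo, (singular_mass n + density_error n <= e%:E)%E.
Proof.
move=> e0; pose e1 := e * (2 * pi) / 3.
have e10 : 0 < e1 by rewrite divr_gt0// mulr_gt0.
have H1 := integral_cd_mean_arc mu_circle mu_inf OP verb reg J e10.
have H2 := defect_cvg e10.
apply: filterS2 H1 H2 => n.
have mk : measurable_fun setT (kap n : borelC R -> R) by exact: measurable_cd_mean.
rewrite (integral_decomposition_in dec (measurable_arc J) mk (kap0 n)).
rewrite -/(singular_mass n).
have fT : leb T \is a fin_num by apply: lebesgue_sub_period => // t [].
have pii0 : 0 <= (2 * pi)^-1 :> R by rewrite invr_ge0 ltW.
have m1 : measurable_fun T (fun t => (kap n (expi t) * (w t / (2 * pi)))%:E).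
  apply/measurable_EFinP; apply: measurable_funTS; apply: measurable_funM => //.
  exact: measurable_funM.
have m2 : measurable_fun T (fun t => (`|1 - w t * kap n (expi t)| / (2 * pi))%:E).
  apply/measurable_EFinP; apply: measurable_funTS; apply: measurable_funM => //.
  apply: measurableT_comp => //; apply: measurable_funB => //; exact: measurable_funM.
have m3 : measurable_fun T (fun t => (defect n t)%:E).
  by apply/measurable_EFinP; apply: measurable_funTS; exact: mdefect.
have key : (density_error n + ((2 * pi)^-1)%:E * leb T =
    \int[leb]_(t in T) (kap n (expi t) * (w t / (2 * pi)))%:E +
    (2 / (2 * pi))%:E * \int[leb]_(t in T) (defect n t)%:E)%E.
  rewrite -integral_cst// /density_error -ge0_integralD; [|exact: mT
    |by move=> t _; rewrite lee_fin divr_ge0// ltW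
    |exact: m2|by move=> t _; rewrite lee_fin|exact: measurable_cst].
  rewrite -ge0_integralZl_EFin; [|exact: mT|by move=> t _; rewrite lee_fin|exact: m3
    |by rewrite mulr_ge0].
  rewrite -ge0_integralD; [|exact: mT
    |by move=> t _; rewrite lee_fin mulr_ge0// divr_ge0// ltW
    |exact: m1|by move=> t _; rewrite -EFinM lee_fin mulr_ge0// mulr_ge0
    |exact: measurable_funeM].
  apply: eq_integral => t _; rewrite /cst -EFinM -!EFinD; congr EFin.
  rewrite /defect; set x := w t * _.
  have -> : kap n (expi t) * (w t / (2 * pi)) = x / (2 * pi) by rewrite /x; ring.
  have [h|h] := leP (1 - x) 0.
    by rewrite ler0_norm//; ring.
  by rewrite gtr0_norm//; ring.
move: key.
have := singular_mass_ge0 n; have := density_error_ge0 n.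
have y0 : (0 <= \int[leb]_(t in T) (kap n (expi t) * (w t / (2 * pi)))%:E)%E.
  by apply: integral_ge0 => t _; rewrite lee_fin mulr_ge0// divr_ge0// ltW.
have q0 : (0 <= \int[leb]_(t in T) (defect n t)%:E)%E.
  by apply: integral_ge0 => t _; rewrite lee_fin.
move: y0 q0 fT.
set y := (\int[leb]_(t in T) (kap n (expi t) * (w t / (2 * pi)))%:E)%E.
set q := (\int[leb]_(t in T) (defect n t)%:E)%E.
set l := leb T; set x := singular_mass n; set r := density_error n.
have tpi : (0 < (2 * pi)%:E :> \bar R)%E by rewrite lte_fin.
move=> y0 q0 fT r0 x0 key H1 H2.
have qf : q \is a fin_num by rewrite ge0_fin_numE//; exact: le_lt_trans H2 (ltry _).
have : (y + x)%E \is a fin_num.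
  have yx0 : (0 <= y + x)%E by exact: adde_ge0.
  rewrite (ge0_fin_numE yx0) ltey; apply/eqP => yx.
  by move: H1; rewrite yx gt0_muley// -(fineK fT) -EFinD leye_eq.
rewrite fin_numD => /andP[yf xf].
have rf : r \is a fin_num.
  rewrite (ge0_fin_numE r0) ltey; apply/eqP => ro.
  by move: key; rewrite ro -(fineK fT) -(fineK yf) -(fineK qf) -!EFinM -EFinD.
move: y0 q0 r0 x0 key H1 H2.
rewrite -(fineK fT) -(fineK yf) -(fineK qf) -(fineK xf) -(fineK rf).
clear qf xf yf rf fT.
move: (fine l) (fine y) (fine q) (fine x) (fine r) => {}l {}y {}q {}x {}r.
rewrite -!EFinM -!EFinD !lee_fin => y0 q0 r0 x0 [key] H1 H2.
move: key H1 H2; rewrite /e1; move: (2 * pi) pi0 => P P0 key H1 H2.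
have Pn0 : P != 0 by rewrite gt_eqF.
have k2 : P * r + l = P * y + 2 * q.
  have := congr1 (fun v => P * v) key.
  by rewrite /= !mulrDr (mulVKf Pn0) mulrA [P * (2 / P)]mulrC (divfK Pn0).
have : P * (x + r) <= P * e by lra.
by rewrite ler_pM2l.
Qed.

End Conclusion.

Unset Implicit Arguments.

Theorem theorem1p4 (R : realType)
    (mu : {finite_measure set (borelC R) -> \bar R})
    (mus : {measure set (borelC R) -> \bar R})
    (w : R -> R) (Phi : nat -> {poly R[i]}) (alpha : nat -> R[i])
    (J : interval R) :
  on_circle mu ->
  infinite_set (msupport mu) ->
  lebesgue_decomposition mu w mus ->
  monic_OPs mu Phi ->
  verblunsky Phi alpha ->
  {ae lebesgue_measure, forall t : R, period t -> circle_arc J (expi t) -> 0 < w t} ->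
  regular_circle alpha ->
  (\int[mus]_(z in circle_arc J) (n.+1%:R^-1 * CD_diag mu Phi n z)%:E)%E
     @[n --> \oo] --> (0 : \bar R)%E
  /\
  (\int[lebesgue_measure]_(t in @period R `&` (@expi R) @^-1` circle_arc J)
      (`|1 - w t * (n.+1%:R^-1 * CD_diag mu Phi n (expi t))| / (2 * pi))%:E)%E
     @[n --> \oo] --> (0 : \bar R)%E.
Proof.
move=> mu_circle mu_inf dec OP verb w_gt0 reg.
have [mw w0 sing muE] := dec.
have mus_lty : (mus setT < +oo)%E.
  apply: (@le_lt_trans _ _ (mu setT)); last by rewrite ltey_eq fin_num_measure.
  rewrite muE// leeDr//; apply: integral_ge0 => t [pt _].
  by rewrite lee_fin divr_ge0// ?w0// mulr_ge0// pi_ge0.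
(* the singular part with its finiteness recorded in its type *)
pose musf : {finite_measure set (borelC R) -> \bar R} := mfrestr measurableT mus_lty.
have musfE A : musf A = mus A by rewrite /musf /= /mfrestr /mrestr setIT.
(* extended by zero, the density is measurable on the whole line *)
pose v : R -> R := w \_ (@period R).
have vE t : period t -> v t = w t by move=> pt; rewrite /v patchE mem_set.
have mv : measurable_fun setT v.
  by apply/(measurable_restrictT _ _).1 => //; exact: measurable_period.
have v0 t : 0 <= v t.
  by rewrite /v patchE; case: ifPn => // /set_mem /w0.
have decv : lebesgue_decomposition mu v musf.
  split.
  - exact: measurable_funTS.
  - by move=> t _; exact: v0.
  - by have [N [mN musN lebN]] := sing; exists N; split => //;
      exact: (etrans (musfE _) musN).
  - move=> A mA; rewrite muE//; congr (_ + _)%E; last exact: (esym (musfE A)).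
    by apply: eq_integral => t /set_mem[pt _]; rewrite vE.
have v_gt0 : {ae lebesgue_measure, forall t : R,
    period t -> circle_arc J (expi t) -> 0 < v t}.
  have [Z [mZ Z0 sZ]] := w_gt0; exists Z; split => // t nt; apply: sZ => H.
  by apply: nt => pt Jt; rewrite vE//; exact: H.
have err := total_error_le mu_circle mu_inf OP verb reg mv v0 decv v_gt0.
have [s0 d0] : (forall n, (0 <= singular_mass mu musf Phi J n)%E) /\
    (forall n, (0 <= density_error mu Phi v J n)%E).
  by split => n; [exact: singular_mass_ge0|exact: density_error_ge0].
split.
  rewrite (_ : (fun n => _) = singular_mass mu musf Phi J); last first.
    by apply/funext => n; apply: eq_measure_integral => A _ _;
      exact: (esym (musfE A)).
  apply: (cvge0P s0).2 => e /err; apply: filterS => n.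
  by apply: le_trans; rewrite leeDl.
rewrite (_ : (fun n => _) = density_error mu Phi v J); last first.
  by apply/funext => n; apply: eq_integral => t /set_mem[pt _]; rewrite vE.
apply: (cvge0P d0).2 => e /err; apply: filterS => n.
by apply: le_trans; rewrite leeDr.
Qed.
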